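(* Consider the algorithm FedCOM$(R,\tau,\eta,\gamma)$ (described in the context) in the homogeneous setting, i.e. all local data distributions and losses are identical, so $f_1=\dots=f_m=f$. Suppose that each $f_j$ is differentiable and $L$-smooth and $f^*=\min f>-\infty$ is attained at $w^{( * )}$; that the compression operator $Q$ satisfies $\mathbb{E}[Q(x)\mid x]=x$ and $\mathbb{E}[\|Q(x)-x\|^2\mid x]\le q\|x\|^2$ for all $x\in\mathbb{R}^d$; and that every stochastic gradient is an unbiased estimator of $\nabla f$ with variance at most $\sigma^2$. Then, for target accuracy $\epsilon>0$: (i) (Nonconvex) With $\eta=\frac{1}{L\gamma}\sqrt{\frac{m}{R\tau(q+1)}}$ and $\gamma\ge m$, the iterates satisfy $\frac1R\sum_{r=0}^{R-1}\mathbb{E}\|\nabla f(w^{(r)})\|_2^2\le\epsilon$ if we set $R=O\left(\frac1\epsilon\right)$ and $\tau=O\left(\frac{q+1}{m\epsilon}\right)$. (ii) (Strongly convex or PL) If in addition $f$ is $\mu$-strongly convex, or satisfies the Polyak-Łojasiewicz condition with constant $\mu>0$, and $\kappa=L/\mu$, then with $\eta=\frac{1}{2L\left(\frac qm+1\right)\tau\gamma}$ and $\gamma\ge m$, the iterates satisfy $\mathbb{E}[f(w^{(R)})-f(w^{( * )})]\le\epsilon$ if we set $R=O\left(\left(\frac qm+1\right)\kappa\log\left(\frac1\epsilon\right)\right)$ and $\tau=O\left(\frac{q+1}{m\left(\frac qm+1\right)\epsilon}\right)$. (iii) (Convex) If in addition $f$ is convex, then with $\eta=\frac{1}{2L\left(\frac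 qm+1\right)\tau\gamma}$ and $\gamma\ge m$, the iterates satisfy $\mathbb{E}[f(w^{(R)})-f(w^{( * )})]\le\epsilon$ if we set $R=O\left(\frac{L\left(1+\frac qm\right)}{\epsilon}\log\left(\frac1\epsilon\right)\right)$ and $\tau=O\left(\frac{(q+1)^2}{m\left(\frac qm+1\right)^2\epsilon^2}\right)$.
   Context: Problem: minimize $f(w)=\frac1m\sum_{j=1}^m f_j(w)$ over $w\in\mathbb{R}^d$, with $m$ devices and $f_j(w)=\mathbb{E}_{z\sim\mathcal P_j}[\ell_j(w,z)]$. FedCOM$(R,\tau,\eta,\gamma)$, with $R$ communication rounds, $\tau$ local updates per round, local learning rate $\eta>0$, global learning rate $\gamma>0$ and initial model $w^{(0)}$: for $r=0,\dots,R-1$, each device $j\in\{1,\dots,m\}$ sets $w_j^{(0,r)}=w^{(r)}$ and, for $c=0,\dots,\tau-1$, draws a fresh independent mini-batch $\mathcal Z_j^{(c,r)}$, computes the stochastic gradient $\tilde g_j^{(c,r)}=\nabla f_j(w_j^{(c,r)};\mathcal Z_j^{(c,r)})$ and sets $w_j^{(c+1,r)}=w_j^{(c,r)}-\eta\tilde g_j^{(c,r)}$. It then sends $\Delta_{j,q}^{(r)}=Q\big((w^{(r)}-w_j^{(\tau,r)})/\eta\big)$ to the server. The server sets $w^{(r+1)}=w^{(r)}-\eta\gamma\,\frac1m\sum_{j=1}^m\Delta_{j,q}^{(r)}$ and broadcasts it. $Q$ is a randomized map $\mathbb{R}^d\to\mathbb{R}^d$, applied with independent randomness across devices and rounds. $L$-smooth: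 $\|\nabla f_j(u)-\nabla f_j(v)\|\le L\|u-v\|$ for all $u,v$. Stochastic gradient assumption: at every $w$, $\mathbb{E}[\tilde g_j]=\nabla f(w)$ and $\mathbb{E}\|\tilde g_j-\nabla f(w)\|^2\le\sigma^2$. PL condition with constant $\mu$: $\frac12\|\nabla f(w)\|^2\ge\mu(f(w)-f(w^{( * )}))$ for all $w$. $O(\cdot)$ convention: ''if we set $R=O(A)$ and $\tau=O(B)$'' means that choices of $R$ of order $A$ and $\tau$ of order $B$ suffice, where the hidden constants depend only on fixed problem data ($L$, $\mu$ where applicable, $\sigma^2$, the initial suboptimality, $\|w^{( * )}\|$) and not on $\epsilon,m,q$.
   Formalization: In (i) the constants may depend on a bound ρ for q/m (false uniformly in q, m); in (ii), (iii) ε ≤ ε₀ for any fixed ε₀ < 1, on which the constants may depend; in (iii) they may also depend on a bound for ‖w⁽⁰⁾‖; orders of R and τ (except τ in (i)) are max(1,·) for integrality. *)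

(* Defs.v *)
From HB Require Import structures.
From mathcomp Require Import all_boot all_order all_algebra.
From mathcomp Require Import all_classical all_reals all_analysis.

Set Implicit Arguments.
Unset Strict Implicit.
Unset Printing Implicit Defensive.

Import Order.TTheory GRing.Theory Num.Theory.
Import numFieldNormedType.Exports.

Local Open Scope classical_set_scope.
Local Open Scope ring_scope.

Section euclidean.
Variables (R : realType) (d : nat).
Implicit Types (u v w : 'rV[R]_d) (f : 'rV[R]_d -> R).

(* The library norm on 'rV[R]_d is the sup norm; the Euclidean one is needed. *)
Definition sqnorm v : R := \sum_i v 0 i ^+ 2.
Definition l2norm v : R := Num.sqrt (sqnorm v).

Definition grad f w : 'rV[R]_d := \row_i 'D_(delta_mx 0 i) f w.

Definition smooth (L : R) f : Prop :=
  (forall w, differentiable f w) /\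
  (forall u v, l2norm (grad f u - grad f v) <= L * l2norm (u - v)).

Definition is_minimizer f (ws : 'rV[R]_d) : Prop := forall w, f ws <= f w.

Definition convex f : Prop := convex_function setT f.

Definition strongly_convex (mu : R) f : Prop :=
  convex (fun w => f w - mu / 2 * sqnorm w).

Definition PL (mu : R) f (ws : 'rV[R]_d) : Prop :=
  forall w, mu * (f w - f ws) <= 2^-1 * sqnorm (grad f w).

(* There is no sigma-algebra on 'rV[R]_d in the library: joint measurability
   in a vector and another argument is expressed on d.-tuple R. *)
Definition row_of_tuple (t : d.-tuple R) : 'rV[R]_d := \row_i tnth t i.

End euclidean.

(* n is of order A with hidden constant c. The factor 2 makes room for
   integrality: there is such a positive n as soon as c * A >= 1 / 2. *)
Definition of_order (R : realType) (c A : R) (n : nat) : Prop :=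
  c * A <= n%:R <= 2 * c * A.

(* Mutual independence of a family F of sets of events. *)
Definition mutually_independent (dO : measure_display)
    (Omega : measurableType dO) (R : realType) (P : probability Omega R)
    (I : eqType) (F : I -> set (set Omega)) : Prop :=
  forall (s : seq I) (A : I -> set Omega), uniq s ->
    (forall i, i \in s -> F i (A i)) ->
    (P (\bigcap_(i in [set` s]) A i) = \prod_(i <- s) P (A i))%E.

Definition sigma_of (dO dT : measure_display) (Omega : measurableType dO)
    (T : measurableType dT) (X : Omega -> T) : set (set Omega) :=
  preimage_set_system setT X measurable.

(* Q is the randomized compression map, its randomness being the second
   argument. Device j uses the mini-batch [batch I j c r] at local step c of
   round r, and compresses with the randomness [seed I j r] in round r. *)
Record fed_instance (R : realType) (m d : nat) := FedInstance {
  dispO : measure_display;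
  Omega : measurableType dispO;
  Pr : probability Omega R;
  dispZ : measure_display;
  Z : measurableType dispZ;
  dispU : measure_display;
  U : measurableType dispU;
  data : 'I_m -> probability Z R;
  loss : 'I_m -> 'rV[R]_d -> Z -> R;
  batch_size : nat;
  batch : 'I_m -> nat -> nat -> Omega -> batch_size.-tuple Z;
  Q : 'rV[R]_d -> U -> 'rV[R]_d;
  seed : 'I_m -> nat -> Omega -> U;
  w0 : 'rV[R]_d
}.

Section fedcom.
Variables (R : realType) (m d : nat) (I : fed_instance R m d).

Definition local_obj (j : 'I_m) (w : 'rV[R]_d) : R :=
  fine ('E_(data I j)[loss j w])%E.

Definition objective (w : 'rV[R]_d) : R := m%:R^-1 * \sum_j local_obj j w.

Definition stoch_grad (j : 'I_m) (w : 'rV[R]_d)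
    (zs : (batch_size I).-tuple (Z I)) : 'rV[R]_d :=
  (batch_size I)%:R^-1 *: \sum_(i < batch_size I)
    grad (fun v => loss j v (tnth zs i)) w.

Section algorithm.
Variables (eta gamma : R) (tau : nat) (omega : Omega I).

(* Model of device j after c local steps of round r, started from w. *)
Fixpoint local_model (j : 'I_m) (r : nat) (w : 'rV[R]_d) (c : nat)
    : 'rV[R]_d :=
  if c is c'.+1 then
    let v := local_model j r w c' in
    v - eta *: stoch_grad j v (batch j c' r omega)
  else w.

Definition message (j : 'I_m) (r : nat) (w : 'rV[R]_d) : 'rV[R]_d :=
  Q (eta^-1 *: (w - local_model j r w tau)) (seed j r omega).

Fixpoint fedcom (r : nat) : 'rV[R]_d :=
  if r is r'.+1 then
    let w := fedcom r' in
    w - (eta * gamma) *: (m%:R^-1 *: \sum_j message j r' w)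
  else w0 I.

End algorithm.

Definition homogeneous : Prop :=
  forall j k, data I j = data I k /\ loss (f:=I) j = loss (f:=I) k.

(* Left: mini-batches, indexed by (j, c, r). Right: compression randomness,
   indexed by (j, r). *)
Definition source_events (s : ('I_m * nat * nat) + ('I_m * nat))
    : set (set (Omega I)) :=
  match s with
  | inl (j, c, r) => sigma_of (batch j c r)
  | inr (j, r) => sigma_of (seed j r)
  end.

Record sampling : Prop := Sampling {
  batch_size_gt0 : (0 < batch_size I)%N;
  batch_measurable : forall j c r, measurable_fun setT (batch (f:=I) j c r);
  seed_measurable : forall j r, measurable_fun setT (seed (f:=I) j r);
  batch_law : forall j c r i (A : set (Z I)), measurable A ->
    Pr I ((fun omega => tnth (batch j c r omega) i) @^-1` A) = data I j A;
  sources_independent : mutually_independent (Pr I) source_events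
}.

Record compression (q : R) : Prop := Compression {
  Q_measurable : forall i, measurable_fun setT
    (fun p : d.-tuple R * U I => Q (row_of_tuple p.1) p.2 0 i);
  Q_unbiased : forall j r x i,
    ('E_(Pr I)[fun omega => Q x (seed j r omega) 0%R i] = (x 0%R i)%:E)%E;
  Q_variance : forall j r x,
    ('E_(Pr I)[fun omega => sqnorm (Q x (seed j r omega) - x)%R]
      <= (q * sqnorm x)%:E)%E
}.

Record stoch_gradients (sigma : R) : Prop := StochGradients {
  stoch_grad_measurable : forall j i, measurable_fun setT
    (fun p : d.-tuple R * (batch_size I).-tuple (Z I) =>
       stoch_grad j (row_of_tuple p.1) p.2 0 i);
  stoch_grad_unbiased : forall j c r w i,
    ('E_(Pr I)[fun omega => stoch_grad j w (batch j c r omega) 0%R i]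
      = (grad objective w 0%R i)%:E)%E;
  stoch_grad_variance : forall j c r w,
    ('E_(Pr I)[fun omega =>
        sqnorm (stoch_grad j w (batch j c r omega) - grad objective w)%R]
      <= (sigma ^+ 2)%:E)%E
}.

Record assumptions (L sigma q : R) (ws : 'rV[R]_d) : Prop := Assumptions {
  m_gt0 : (0 < m)%N;
  q_ge0 : 0 <= q;
  homog : homogeneous;
  loss_integrable : forall j w,
    (data I j).-integrable setT (fun z => (loss j w z)%:E);
  local_smooth : forall j, smooth L (local_obj j);
  ws_min : is_minimizer objective ws;
  sampled : sampling;
  compressed : compression q;
  gradients : stoch_gradients sigma
}.

Definition mean_sq_grad (eta gamma : R) (tau rounds : nat) : \bar R :=
  (rounds%:R^-1%:E * \sum_(r < rounds)
    'E_(Pr I)[fun omega => sqnorm (grad objective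
                             (fedcom eta gamma tau omega r))])%E.

Definition mean_gap (eta gamma : R) (tau rounds : nat) (ws : 'rV[R]_d)
    : \bar R :=
  ('E_(Pr I)[fun omega => (objective (fedcom eta gamma tau omega rounds)
                          - objective ws)%R])%E.

End fedcom.

(* Main.v *)
Require Import Defs.
From HB Require Import structures.
From mathcomp Require Import all_boot all_order all_algebra.
From mathcomp Require Import all_classical all_reals all_analysis.
From mathcomp Require Import measurable_realfun ring lra.
Import Order.TTheory GRing.Theory Num.Theory.
Import numFieldNormedType.Exports.
Local Open Scope ring_scope.
Set Implicit Arguments.
Unset Strict Implicit.
Unset Printing Implicit Defensive.

(* Write s = eta * gamma, and let D_j be the sum of the tau stochastic gradients
   of device j in a round, so that the server moves by - s times the average of
   Q(D_j).  Every mini-batch gradient is the true gradient at its local model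
   plus a noise that is centred given all the other sources of randomness, and
   likewise for Q(D_j) - D_j.  The noises are thus pairwise orthogonal in L^2:
   the mini-batch noises contribute of the order of tau sigma^2 / m to the
   second moment of the average D_j, and the compression multiplies it by at
   most 1 + q / m, up to tau sigma^2 q / m.  As soon as
   L s tau (1 + q / m) <= 1/2 and gamma >= m, the negative term
   - s / 2 * sum |grad f (local models)|^2 in the smoothness estimate absorbs
   both the second moment of the step and the drift of the local models, leaving
     E f(w+) <= E f(w) - s tau / 2 * E |grad f(w)|^2 + N,
     N = 4 L s^2 tau sigma^2 (1 + q) / m.
   Summing gives (i); with the PL inequality the gap contracts linearly, which
   gives (ii).  In the convex case the same absorption shows that
   L / 2 * E |w - ws|^2 grows by at most N per round, so it stays bounded by some
   constant over the whole run, and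
   2 (f(w) - f(ws)) <= k |grad f(w)|^2 + |w - ws|^2 / k with k of order 1 / eps is
   a PL inequality with constant of order eps up to an error eps / 4: this
   is (iii). *)

(** * Smooth and convex functions *)

Section dot_product.
Context {R : realType} {d : nat}.
Implicit Types u v w : 'rV[R]_d.

Definition dot u v : R := \sum_i u 0 i * v 0 i.

Lemma sqnormE u : sqnorm u = dot u u.
Proof. by apply: eq_bigr => i _; rewrite expr2. Qed.

Lemma dotC u v : dot u v = dot v u.
Proof. by apply: eq_bigr => i _; rewrite mulrC. Qed.

Lemma dotDl u v w : dot (u + v) w = dot u w + dot v w.
Proof. by rewrite -big_split; apply: eq_bigr => i _; rewrite mxE mulrDl. Qed.

Lemma dotZl (k : R) u v : dot (k *: u) v = k * dot u v.
Proof. by rewrite mulr_sumr; apply: eq_bigr => i _; rewrite mxE mulrA. Qed.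

Lemma dotNl u v : dot (- u) v = - dot u v.
Proof. by rewrite -scaleN1r dotZl mulN1r. Qed.

Lemma dotDr u v w : dot w (u + v) = dot w u + dot w v.
Proof. by rewrite dotC dotDl !(dotC w). Qed.

Lemma dotZr (k : R) u v : dot u (k *: v) = k * dot u v.
Proof. by rewrite dotC dotZl dotC. Qed.

Lemma dotNr u v : dot u (- v) = - dot u v.
Proof. by rewrite dotC dotNl dotC. Qed.

Lemma dot0l u : dot 0 u = 0.
Proof. by rewrite -(scale0r (0 : 'rV_d)) dotZl mul0r. Qed.

Lemma dot_suml (I : Type) (r : seq I) (F : I -> 'rV[R]_d) v :
  dot (\sum_(i <- r) F i) v = \sum_(i <- r) dot (F i) v.
Proof.
by elim: r => [|i r IH]; rewrite ?big_nil ?dot0l// !big_cons dotDl IH.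
Qed.

Lemma dot_sumr (I : Type) (r : seq I) (F : I -> 'rV[R]_d) v :
  dot v (\sum_(i <- r) F i) = \sum_(i <- r) dot v (F i).
Proof. by rewrite dotC dot_suml; apply: eq_bigr => i _; rewrite dotC. Qed.

Lemma sqnorm_ge0 u : 0 <= sqnorm u.
Proof. by apply: sumr_ge0 => i _; exact: sqr_ge0. Qed.

Definition dotE := (dotDl, dotDr, dotNl, dotNr, dotZl, dotZr).

Lemma sqnormZ (k : R) u : sqnorm (k *: u) = k ^+ 2 * sqnorm u.
Proof. by rewrite !sqnormE !dotE; ring. Qed.

Lemma sqnormN u : sqnorm (- u) = sqnorm u.
Proof. by rewrite !sqnormE !dotE opprK. Qed.

Lemma l2norm_sq u : l2norm u ^+ 2 = sqnorm u.
Proof. by rewrite sqr_sqrtr ?sqnorm_ge0. Qed.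

Lemma young_dot (k : R) u v : 0 < k ->
  2 * dot u v <= k * sqnorm u + k^-1 * sqnorm v.
Proof.
move=> k0; have := sqnorm_ge0 (k *: u - v).
rewrite sqnormE !dotE -!sqnormE (dotC v u) => h.
have -> : k * sqnorm u + k^-1 * sqnorm v =
    k^-1 * (k * (k * sqnorm u) + sqnorm v) by field; rewrite gt_eqF.
rewrite -(ler_pM2l k0) [k * (k^-1 * _)]mulrA divff ?gt_eqF// mul1r.
by lra.
Qed.

(** Young's inequality with weight 1/4. The split is uneven on purpose: [u] will be a gradient part
    that [residual_le] must absorb, which leaves room only for a factor at most 4/3, while [v] will
    be noise and may cost more. *)
Lemma sqnormD_young u v :
  sqnorm (u + v) <= 5 / 4 * sqnorm u + 5 * sqnorm v.
Proof.
have := @young_dot (4^-1) u v; rewrite invrK.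
rewrite [sqnorm (u + v)]sqnormE !dotE -!sqnormE (dotC v u) => /(_ _) h.
by have := h ltac:(lra); lra.
Qed.

Lemma sqnormD_le2 u v : sqnorm (u + v) <= 2 * sqnorm u + 2 * sqnorm v.
Proof.
have := @young_dot 1 u v ltr01; rewrite invr1 [sqnorm (u + v)]sqnormE !dotE.
by rewrite -!sqnormE (dotC v u); lra.
Qed.

Lemma sqnorm_sum_le (I : finType) (F : I -> 'rV[R]_d) :
  sqnorm (\sum_i F i) <= #|I|%:R * \sum_i sqnorm (F i).
Proof.
rewrite sqnormE dot_suml.
under eq_bigr do rewrite dot_sumr.
have h i j : dot (F i) (F j) <= 2^-1 * sqnorm (F i) + 2^-1 * sqnorm (F j).
  by have := @young_dot 1 (F i) (F j) ltr01; rewrite invr1; lra.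
apply: (le_trans (ler_sum _ (fun i _ => ler_sum _ (fun j _ => h i j)))).
under eq_bigr do rewrite big_split.
rewrite big_split /= exchange_big /= -mulr2n sumr_const -mulr_sumr.
rewrite -[_ *+ 2]mulr_natl -[_ *+ #|_|]mulr_natl.
rewrite (_ : forall x : R, 2 * (#|I|%:R * (2^-1 * x)) = #|I|%:R * x)//.
by move=> x; field.
Qed.

Lemma normr_coord_le u i : `|u 0 i| <= l2norm u.
Proof.
rewrite -sqrtr_sqr ler_sqrt ?sqnorm_ge0// /sqnorm (bigD1 i)//= lerDl.
by apply: sumr_ge0 => j _; exact: sqr_ge0.
Qed.

End dot_product.

Section smooth_functions.
Context {R : realType} {d : nat}.
Variables (L : R) (f : 'rV[R]_d -> R).
Hypotheses (L0 : 0 < L) (sf : smooth L f).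
Implicit Types u v w h : 'rV[R]_d.

Lemma derive_grad w h : 'D_h f w = dot (grad f w) h.
Proof.
have df := sf.1 w.
rewrite deriveE// {1}(row_sum_delta h) linear_sum /dot.
apply: eq_bigr => i _; rewrite linearZ /= mxE -deriveE// mulrC.
by [].
Qed.

Lemma grad_lip u v : sqnorm (grad f u - grad f v) <= L ^+ 2 * sqnorm (u - v).
Proof.
rewrite -!l2norm_sq -exprMn lerXn2r ?nnegrE ?sqrtr_ge0//.
  by rewrite mulr_ge0 ?sqrtr_ge0// ltW.
exact: sf.2.
Qed.

(** Young's inequality with weight 1 / (L t), applied to [g] and [- g], plays the part of
    Cauchy-Schwarz: as |g| <= L t |h|, both of its terms are at most L t |h|^2. The weight makes
    sense only for t > 0, so t = 0 is separate. *)
Lemma dot_grad_diff w h (t : R) : 0 <= t ->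
  `|dot (grad f (w + t *: h) - grad f w) h| <= L * t * sqnorm h.
Proof.
move=> t0.
have [->|tn0] := eqVneq t 0.
  by rewrite scale0r addr0 subrr dot0l normr0 mulr0 mul0r.
have tp : 0 < t by rewrite lt_neqAle eq_sym tn0.
have Lt : 0 < L * t by rewrite mulr_gt0.
set g := _ - _.
have gl : sqnorm g <= (L * t) ^+ 2 * sqnorm h.
  by rewrite (le_trans (grad_lip _ _))// addrC addKr sqnormZ exprMn mulrA.
have gl2 : (L * t)^-1 * sqnorm g <= L * t * sqnorm h.
  by rewrite ler_pdivrMl// mulrA -expr2.
have := @young_dot _ _ (L * t)^-1 g h; rewrite invr_gt0 invrK => /(_ Lt).
have := @young_dot _ _ (L * t)^-1 (- g) h; rewrite invr_gt0 invrK => /(_ Lt).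
rewrite sqnormN dotNl => h1 h2.
by rewrite ler_norml; apply/andP; split; lra.
Qed.

Lemma is_derive_line w h (t : R) :
  is_derive t 1 (fun t : R => f (w + t *: h)) (dot (grad f (w + t *: h)) h).
Proof.
(* The difference quotient of the restriction to the line is the directional one of [f] at
   [w + t *: h], so existence and value of the limit carry over. *)
have E : (fun s : R => s^-1 *: (f (w + (s *: (1 : R) + t) *: h) -
                               f (w + t *: h))) =
    (fun s : R => s^-1 *: (f (s *: h + (w + t *: h)) - f (w + t *: h))).
  by apply/funext => s; rewrite scaler1 scalerDl addrCA.
have [cv _] : derivable f (w + t *: h) h /\ True.
  by split => //; exact/diff_derivable/sf.1.
apply: DeriveDef; first by rewrite /derivable E.
by rewrite -derive_grad /derive E.
Qed.

Lemma descent_both w h :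
  `|f (w + h) - f w - dot (grad f w) h| <= L / 2 * sqnorm h.
Proof.
have key (s : R) : `|s| = 1 ->
    s * (f (w + h) - f w - dot (grad f w) h) <= L / 2 * sqnorm h.
  move=> s1.
  (* The sign [s] treats both sides of the absolute value at once. On [0, 1] the derivative [g'] is
     nonpositive by [dot_grad_diff], so the mean value theorem gives g 1 <= g 0, which is the
     claim. *)
  pose g (t : R) : R := s * (f (w + t *: h) - t * dot (grad f w) h)
                    - t ^+ 2 * (L / 2 * sqnorm h).
  pose g' (t : R) : R := s * dot (grad f (w + t *: h) - grad f w) h
                    - t * (L * sqnorm h).
  have dg (t : R) : is_derive t 1 g (g' t).
    have dl := is_derive_line w h t.
    pose F (t : R) := f (w + t *: h).
    have -> : g = s *: (F - (dot (grad f w) h) *: id)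
                  - (L / 2 * sqnorm h) *: (id ^+ 2 : R -> R).
      apply/funext => u; rewrite /g /F.
      rewrite !fctE /GRing.scale /=; ring.
    apply: is_derive_eq.
    have sc (a b : R) : a *: (b : R^o) = a * b by [].
    by rewrite /g' !dotE !sc expr1; field.
  have [] := @MVT_segment _ g g' 0 1 ler01.
  - apply: continuous_subspaceT => x.
    exact/differentiable_continuous/derivable1_diffP.
  move=> t; rewrite in_itv/= => /andP[t0 t1].
  rewrite /g /g' scale1r scale0r addr0.
  have ub : s * dot (grad f (w + t *: h) - grad f w) h <= L * t * sqnorm h.
    rewrite (le_trans (ler_norm _))// normrM s1 mul1r.
    exact: dot_grad_diff.
  lra.
have := key 1 (normr1 _); have := key (-1) (normrN1 _).
by rewrite ler_norml => h1 h2; apply/andP; split; lra.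
Qed.

Lemma descent w h :
  f (w + h) <= f w + dot (grad f w) h + L / 2 * sqnorm h.
Proof. have := descent_both w h; rewrite ler_norml => /andP[]; lra. Qed.

Lemma descent_lower w h :
  f w + dot (grad f w) h - L / 2 * sqnorm h <= f (w + h).
Proof. have := descent_both w h; rewrite ler_norml => /andP[]; lra. Qed.

(** A gradient step of length 1 / L lowers [f] by at least |grad f|^2 / (2 L), which is impossible
    at a minimizer unless the gradient vanishes. *)
Lemma grad_min ws : is_minimizer f ws -> grad f ws = 0.
Proof.
move=> fm; have := descent ws (- L^-1 *: grad f ws).
have /le_trans h := fm (ws + - L^-1 *: grad f ws).
move=> {}/h; rewrite dotZr sqnormZ -sqnormE sqrrN => h.
have : (2 * L)^-1 * sqnorm (grad f ws) <= 0.
  suff : L / 2 * (L^-1 ^+ 2 * sqnorm (grad f ws)) - L^-1 * sqnorm (grad f ws)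
    = - ((2 * L)^-1 * sqnorm (grad f ws)) by lra.
  by field; rewrite gt_eqF.
rewrite pmulr_rle0 ?invr_gt0 ?mulr_gt0// => h0.
have /eqP : sqnorm (grad f ws) = 0 by apply/eqP; rewrite eq_le h0 sqnorm_ge0.
rewrite psumr_eq0 => [/allP z|i _]; last exact: sqr_ge0.
apply/rowP => i; rewrite [RHS]mxE; apply/eqP; rewrite -sqrf_eq0.
exact: (implyP (z i (mem_index_enum i))).
Qed.

Lemma gap_le ws w : is_minimizer f ws -> f w - f ws <= L / 2 * sqnorm (w - ws).
Proof.
move=> /grad_min g0; have := descent ws (w - ws).
by rewrite addrC subrK g0 dot0l; lra.
Qed.

End smooth_functions.

Section convex_functions.
Context {R : realType} {d : nat}.
Variables (L : R) (f : 'rV[R]_d -> R).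
Hypotheses (L0 : 0 < L) (sf : smooth L f).
Implicit Types u v w h : 'rV[R]_d.

Lemma convexE (g : 'rV[R]_d -> R) w h (t : R) : convex g -> 0 <= t <= 1 ->
  g (w + t *: h) <= (1 - t) * g w + t * g (w + h).
Proof.
move=> cg /andP[t0 t1].
have : g (t *: (w + h) + (1 - t) *: w) <= t * g (w + h) + (1 - t) * g w.
  by have := cg (Itv01 t0 t1) (w + h) w; rewrite !inE; apply.
rewrite (_ : _ *: (w + h) + _ = w + t *: h) 1?[X in _ <= X]addrC//.
by rewrite scalerDr scalerBl scale1r addrC addrA subrK.
Qed.

(* Strong convexity and the quadratic lower bound at a small step [t] give the
   first-order inequality up to a term linear in [t]. *)
Lemma strongly_convex_ge (mu : R) w h : 0 <= mu -> strongly_convex mu f ->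
  f w + dot (grad f w) h + mu / 2 * sqnorm h <= f (w + h).
Proof.
move=> mu0 cf; rewrite leNgt; apply/negP => lt.
set e := f w + dot (grad f w) h + mu / 2 * sqnorm h - f (w + h).
have e0 : 0 < e by rewrite /e; lra.
pose c := (L + mu) / 2 * sqnorm h.
have c0 : 0 <= c by rewrite mulr_ge0 ?sqnorm_ge0// divr_ge0// addr_ge0// ltW.
(* If the inequality fails by e > 0, convexity along the segment and smoothness give t e <= t^2 c
   for every t in [0, 1]. This [t] satisfies t c < e, a contradiction. *)
pose t : R := e / (e + c + c).
have d0 : 0 < e + c + c by lra.
have tp : 0 < t by rewrite divr_gt0.
have t1 : t <= 1 by rewrite ler_pdivrMr// mul1r; lra.
have tc : t * c < e.
  by rewrite mulrAC -mulrA gtr_pMr// ltr_pdivrMr// mul1r; lra.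
have := @convexE _ w h t cf; rewrite t1 ltW// => /(_ isT).
have := descent_lower L0 sf w (t *: h).
rewrite dotZr sqnormZ [sqnorm (w + _)]sqnormE [sqnorm (w + h)]sqnormE !dotE.
rewrite -!sqnormE (dotC h w) => h1 h2.
suff : t * e <= t * (t * c) by rewrite ler_pM2l// leNgt tc.
rewrite /e /c; lra.
Qed.

Lemma convex_ge w h : convex f -> f w + dot (grad f w) h <= f (w + h).
Proof.
move=> cf; have := @strongly_convex_ge 0 w h (lexx _).
rewrite mul0r mul0r addr0; apply.
rewrite /strongly_convex (_ : (fun w => _) = f)//.
by apply/funext => u; rewrite !mul0r subr0.
Qed.

(** In the quadratic lower bound from [w] towards [ws], Young's inequality with weight 1 / mu
    cancels the quadratic term exactly. *)
Lemma strongly_convex_PL (mu : R) ws : 0 < mu -> strongly_convex mu f ->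
  PL mu f ws.
Proof.
move=> mu0 cf w; have := strongly_convex_ge w (ws - w) (ltW mu0) cf.
rewrite [w + _]addrC subrK => h.
have := @young_dot _ _ mu^-1 (grad f w) (- (ws - w)).
rewrite invr_gt0 invrK sqnormN dotNr => /(_ mu0) h2.
have : mu * (f w - f ws) <= mu * (2^-1 * (mu^-1 * sqnorm (grad f w))).
  by rewrite ler_pM2l//; lra.
by rewrite [mu * (2^-1 * _)]mulrCA mulVKf ?gt_eqF.
Qed.

(* The three-point inequality: descent from [ws] to [ws + grad f y / L]
   against the tangent at [y], then smoothness between [x] and [y]. *)
Lemma convex_three_points ws x y : convex f -> is_minimizer f ws ->
  f x - f ws + (2 * L)^-1 * sqnorm (grad f y) - L / 2 * sqnorm (x - y)
  <= dot (grad f y) (x - ws).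
Proof.
move=> cf fm; set g := grad f y.
have h1 := @descent _ _ _ _ L0 sf ws (L^-1 *: g).
have h2 := convex_ge y (ws + L^-1 *: g - y) cf.
have h3 := @descent _ _ _ _ L0 sf y (x - y).
move: h1 h2 h3; rewrite (grad_min L0 sf fm) ![y + _]addrC !subrK -/g dot0l.
rewrite sqnormZ !dotE -sqnormE.
have -> : L / 2 * (L^-1 ^+ 2 * sqnorm g) = (2 * L)^-1 * sqnorm g.
  by field; rewrite gt_eqF.
have -> : L^-1 * sqnorm g = 2 * ((2 * L)^-1 * sqnorm g).
  by field; rewrite gt_eqF.
by lra.
Qed.

End convex_functions.

(** * Measurability of functions of a row vector *)

Section row_measurability.
Local Open Scope classical_set_scope.
Context {R : realType} {d : nat}.

(* Functions on row vectors are read on tuples, which carry a sigma-algebra;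
   a continuous function is the limit of its values at the points rounded to
   the lattice of mesh 1 / (n + 1). *)
Lemma measurable_continuous_row (g : 'rV[R]_d -> R) : continuous g ->
  measurable_fun setT (fun t : d.-tuple R => g (row_of_tuple t)).
Proof.
move=> cg.
pose lattice (n : nat) (k : {ffun 'I_d -> int}) : 'rV[R]_d :=
  \row_i ((k i)%:~R / n.+1%:R).
pose round n (t : d.-tuple R) := [ffun i => Num.floor (n.+1%:R * tnth t i)].
pose gn n (t : d.-tuple R) := g (lattice n (round n t)).
apply: (@measurable_fun_cvg _ _ _ _ gn) => [n|t _].
- move=> _ B mB; rewrite setTI.
  pose cell (k : {ffun 'I_d -> int}) := \bigcap_(i in [set: 'I_d])
    [set t : d.-tuple R | (k i)%:~R <= n.+1%:R * tnth t i < (k i + 1)%:~R].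
  have mcell k : measurable (cell k).
    apply: fin_bigcap_measurable => // i _.
    rewrite (_ : [set _ | _] = (fun t : d.-tuple R => n.+1%:R * tnth t i) @^-1`
      `[(k i)%:~R, (k i + 1)%:~R[).
      rewrite -[X in measurable X]setTI.
      apply: (measurable_funM _ (measurable_tnth i)) => //.
    by apply/seteqP; split => t /=; rewrite in_itv.
  (* [gn n] is constant on each cell, so the preimage is a union of cells, made countable by running
     over the codes [p] of integer vectors. A code that decodes to nothing, or to a point outside
     [B], contributes the empty set. *)
  have -> : gn n @^-1` B = \bigcup_p
      (if unpickle p is Some k then
         if `[< B (g (lattice n k)) >] then cell k else set0 else set0).
    apply/seteqP; split => t /=.
    - move=> Bt; exists (pickle (round n t)) => //; rewrite pickleK.
      rewrite asboolT// => i _ /=; rewrite ffunE.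
      by rewrite Num.Theory.floor_le Num.Theory.floorD1_gt.
    - move=> [p _]; case: unpickle => // k.
      case: asboolP => // Bk ct; rewrite /gn (_ : round n t = k)//.
      apply/ffunP => i; rewrite ffunE; apply: Num.Theory.floor_def.
      exact: ct.
  apply: bigcup_measurable => p _; case: unpickle => // k.
  by case: ifP => // _; exact: measurable0.
- apply: (@continuous_cvg _ _ _ _ _ _ g); first exact: cg.
  apply/cvg_ballP => e e0.
  near=> n; split=> // i j.
  rewrite !mxE ffunE -ball_normE /ball_ /=.
  have c0 : 0 < n.+1%:R :> R by rewrite ltr0n.
  have /andP[f1 f2] := floor_itv (n.+1%:R * tnth t j).
  rewrite (_ : _ - _ = (n.+1%:R * tnth t j
      - (Num.floor (n.+1%:R * tnth t j))%:~R) / n.+1%:R); last first.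
    by field; rewrite gt_eqF.
  rewrite ger0_norm ?divr_ge0 ?subr_ge0// ?ltW// ?ltr0n//.
  apply: (@lt_trans _ _ n.+1%:R^-1).
    rewrite -[ltRHS]mul1r ltr_pM2r ?invr_gt0// ltrBlDr.
    by move: f2; rewrite intrD addrC.
  by near: n; exact: (near_infty_natSinv_lt (PosNum e0)).
Unshelve. all: by end_near.
Qed.

Variables (L : R) (f : 'rV[R]_d -> R).
Hypotheses (L0 : 0 < L) (sf : smooth L f).

Lemma smooth_continuous : continuous f.
Proof. by move=> w; exact/differentiable_continuous/sf.1. Qed.

Lemma grad_coord_continuous i : continuous (fun w => grad f w 0 i).
Proof.
move=> w.
apply: (proj2 (@cvgrPdist_lt _ R^o _ (nbhs w) _ (fun v => grad f v 0 i)
  (grad f w 0 i))).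
move=> e e0.
(* This passes from the sup-norm ball to the Euclidean norm. In a ball of radius r <= 1 the square
   of a coordinate is at most its absolute value, hence below e^2 / K; summing over d coordinates
   and applying the Lipschitz bound gives L^2 d e^2 / K, and the added 1 makes this less than
   e^2. *)
pose K := L ^+ 2 * d%:R + 1.
have K0 : 0 < K by rewrite ltr_wpDl// mulr_ge0// sqr_ge0.
pose r := Num.min 1 (e ^+ 2 / K).
have r0 : 0 < r by rewrite lt_min ltr01 divr_gt0 ?exprn_gt0.
have near_r : \forall v \near w, ball w r v by exact: nbhsx_ballx.
apply: filterS near_r => v [_ wv] /=.
rewrite -(ltr_pXn2r (n := 2)) ?nnegrE ?normr_ge0 ?(ltW e0)//.
have /lerXn2r : `|(grad f w - grad f v) 0 i| <= l2norm (grad f w - grad f v).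
  exact: normr_coord_le.
rewrite !nnegrE normr_ge0 sqrtr_ge0 => /(_ 2 isT isT); rewrite l2norm_sq.
move=> /le_trans/(_ (grad_lip L0 sf _ _)); rewrite !mxE => /le_lt_trans; apply.
have : sqnorm (w - v) <= d%:R * (e ^+ 2 / K).
  rewrite /sqnorm -[d in leRHS]card_ord -sum1_card natr_sum mulr_suml.
  apply: ler_sum => k _; rewrite mul1r !mxE.
  have := wv 0 k; rewrite -ball_normE /ball_ /= lt_min => /andP[h1 h2].
  rewrite -real_normK ?num_real// expr2.
  apply: le_trans (ltW h2); rewrite ler_piMl// ltW//.
move=> h; apply: (@le_lt_trans _ _ (L ^+ 2 * (d%:R * (e ^+ 2 / K)))).
  by rewrite ler_wpM2l ?sqr_ge0.
have e2 : 0 < e ^+ 2 by rewrite exprn_gt0.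
rewrite !mulrA ltr_pdivrMr// mulrC /K mulrDr mulr1.
rewrite (_ : e * _ = e ^+ 2 * (L ^+ 2 * d%:R)) ?ltrDl//.
by rewrite expr2; ring.
Qed.

Lemma measurable_smooth :
  measurable_fun setT (fun t : d.-tuple R => f (row_of_tuple t)).
Proof. by apply: (measurable_continuous_row (g := f)); exact: smooth_continuous. Qed.

Lemma measurable_grad i :
  measurable_fun setT (fun t : d.-tuple R => grad f (row_of_tuple t) 0 i).
Proof.
apply: (measurable_continuous_row (g := fun w => grad f w 0 i)).
exact: grad_coord_continuous.
Qed.

End row_measurability.

(** * Independence *)

Section freezing.
Local Open Scope classical_set_scope.
Local Open Scope ereal_scope.
Context d0 d1 d2 (Omega : measurableType d0) (T1 : measurableType d1)
  (T2 : measurableType d2) (R : realType) (P : probability Omega R).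
Variables (X1 : {mfun Omega >-> T1}) (X2 : {mfun Omega >-> T2}).
Hypothesis indep : forall A B, measurable A -> measurable B ->
  P (X1 @^-1` A `&` X2 @^-1` B) = P (X1 @^-1` A) * P (X2 @^-1` B).

Let X := fun omega => (X1 omega, X2 omega).
Let mX : measurable_fun setT X. Proof. exact: measurable_fun_pair. Qed.
HB.instance Definition _ := isMeasurableFun.Build _ _ _ _ X mX.
Let mu1 := distribution P X1.
Let mu2 := distribution P X2.

Let joint_law A : measurable A -> distribution P X A = (mu1 \x mu2) A.
Proof. by move=> mA; apply/esym/product_measure_unique. Qed.

(** By independence the pair has the product law, so by Tonelli [X2] can be integrated out first,
    with [X1] frozen at a point. It is an inequality because only a bound on the variance is
    assumed. *)
Lemma ge0_freezing_le (phi : T1 * T2 -> \bar R) (c : T1 -> \bar R) :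
  measurable_fun setT phi -> (forall p, 0 <= phi p) -> measurable_fun setT c ->
  (forall x, \int[P]_w phi (x, X2 w) <= c x) ->
  \int[P]_w phi (X1 w, X2 w) <= \int[P]_w c (X1 w).
Proof.
move=> mphi phi0 mc phic.
have -> : \int[P]_w phi (X1 w, X2 w) = \int[distribution P X]_p phi p.
  by rewrite ge0_integral_distribution.
rewrite (@eq_measure_integral _ _ _ setT (mu1 \x mu2)); last first.
  by move=> A mA _; exact: joint_law.
rewrite fubini_tonelli1//.
have FE x : fubini_F mu2 phi x = \int[P]_w phi (x, X2 w).
  rewrite /fubini_F ge0_integral_distribution//.
  exact: (measurableT_comp mphi (measurable_fun_pair _ _)).
have c0 x : 0 <= c x by apply: le_trans (phic x); exact: integral_ge0.
have -> : \int[P]_w c (X1 w) = \int[mu1]_x c x.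
  by rewrite ge0_integral_distribution.
apply: ge0_le_integral => //.
- by move=> x _; rewrite FE; exact: integral_ge0.
- exact: measurable_fun_fubini_tonelli_F.
- by move=> x _; rewrite FE.
Qed.

(** The signed counterpart, by Fubini: integrability is required both jointly and for each frozen
    section. *)
Lemma freezing0 (phi : T1 * T2 -> \bar R) :
  measurable_fun setT phi ->
  P.-integrable setT (fun w => phi (X1 w, X2 w)) ->
  (forall x, P.-integrable setT (fun w => phi (x, X2 w))) ->
  (forall x, \int[P]_w phi (x, X2 w) = 0) ->
  \int[P]_w phi (X1 w, X2 w) = 0.
Proof.
move=> mphi iphi iphi2 phi0.
have iX : (distribution P X).-integrable setT phi.
  exact: integrable_pushforward.
have -> : \int[P]_w phi (X1 w, X2 w) = \int[distribution P X]_p phi p.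
  by rewrite integral_distribution.
have i12 : (mu1 \x mu2).-integrable setT phi.
  apply/integrableP; split=> //; move/integrableP : iX => [_].
  rewrite (@eq_measure_integral _ _ _ setT (mu1 \x mu2))//.
  by move=> A mA _; exact: joint_law.
rewrite (@eq_measure_integral _ _ _ setT (mu1 \x mu2)); last first.
  by move=> A mA _; exact: joint_law.
rewrite -integral12_prod_meas1//.
apply: integral0_eq => x _; rewrite /fubini_F integral_distribution//.
- exact: phi0.
- exact: (measurableT_comp mphi (measurable_fun_pair _ _)).
- exact: iphi2.
Qed.

End freezing.

Section independence.
Local Open Scope classical_set_scope.
Context dO (Omega : measurableType dO) (R : realType) (P : probability Omega R).
Context (I : eqType) (F : I -> set (set Omega)).
Hypothesis F_measurable : forall i, F i `<=` measurable.
Hypothesis FT : forall i, F i setT.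
Hypothesis FI : forall i, setI_closed (F i).
Hypothesis indF : mutually_independent P F.

(** The proofs below use membership in this family as membership in [F k] for some [k != i], which
    is how a union reads, whereas the body shows an intersection. *)
Definition others (i : I) : set (set Omega) :=
  \bigcup_(k in [set k | k != i]) F k.

(** A pi-lambda argument. The set [C] of finite intersections of events of sources other than [i] is
    a pi-system; on it the finite measures P (. & B) and P B * P agree by mutual independence, hence
    they agree on the sigma-algebra it generates. *)
Lemma independent_of_others i A B : <<s others i >> A -> F i B ->
  P (A `&` B) = (P A * P B)%E.
Proof.
move=> sA FB.
pose C := [set X | exists (s : seq I) (E : I -> set Omega),
  [/\ i \notin s, forall k, k \in s -> F k (E k) &
      X = \bigcap_(k in [set` s]) E k]].
have oC : others i `<=` C.
  move=> X [k /= ki FX]; exists [:: k], (fun=> X); split.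
  - by rewrite inE eq_sym.
  - by move=> k'; rewrite inE => /eqP ->.
  - by apply/seteqP; split => [w Xw k' _//|w /(_ k)]; apply; rewrite /= inE.
have CI : setI_closed C.
  move=> _ _ [s1 [E1 [i1 F1 ->]]] [s2 [E2 [i2 F2 ->]]].
  exists (s1 ++ s2), (fun k => (if k \in s1 then E1 k else setT) `&`
                             (if k \in s2 then E2 k else setT)); split.
  - by rewrite mem_cat negb_or i1.
  - move=> k _; apply: FI; case: ifPn => // k1; [exact: F1|exact: F2].
  - apply/seteqP; split => w /=.
    + move=> [h1 h2] k _; split; case: ifPn => //.
        exact: h1.
      exact: h2.
    + move=> h; split => k /= ks.
        by have [] := h k _; rewrite /= ?mem_cat ?ks//; rewrite ks.
      by have [] := h k _; rewrite /= ?mem_cat ks ?orbT.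
have CT : C setT.
  by exists [::], (fun=> setT); split => //; apply/seteqP; split.
have mC : C `<=` measurable.
  move=> _ [s [E [_ FE ->]]]; apply: fin_bigcap_measurable.
    exact: finite_seq.
  by move=> k /= ks; apply: (@F_measurable k); exact: FE.
have mB : measurable B by exact: F_measurable FB.
have PB0 : 0 <= fine (P B) by apply: fine_ge0; exact: measure_ge0.
have EB : (fine (P B))%:E = P B by rewrite fineK// fin_num_measure.
have sC : <<s C >> A.
  by apply: sub_sigma_algebra2 sA => //; exact: sub_smallest2r.
have key X : C X -> P (X `&` B) = (P B * P X)%E.
  (* [mutually_independent] speaks of duplicate-free lists, hence [undup]. As [i] is not in [s],
     [E'] can carry [B] at index [i], so that intersecting with [B] amounts to running over
     [i :: u]. *)
  move=> [s [E [si FE ->]]]; pose u := undup s.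
  pose E' k := if k == i then B else E k.
  have E's k : k \in u -> E' k = E k.
    rewrite /E' mem_undup => ks; case: eqP ks => // -> is_.
    by rewrite is_ in si.
  have XE : \bigcap_(k in [set` s]) E k = \bigcap_(k in [set` u]) E' k.
    apply/seteqP; split => w h k /= ks; have := h k.
      by rewrite E's//= -mem_undup; apply.
    by rewrite E's ?mem_undup//=; apply; rewrite /= mem_undup.
  have FE' k : k \in i :: u -> F k (E' k).
    rewrite inE => /orP[/eqP ->|ku]; first by rewrite /E' eqxx.
    by rewrite E's//; apply: FE; rewrite -mem_undup.
  have XB : \bigcap_(k in [set` u]) E' k `&` B =
            \bigcap_(k in [set` i :: u]) E' k.
    apply/seteqP; split => w.
      move=> [h Bw] k /=; rewrite inE => /orP[/eqP ->|]; last exact: h.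
      by rewrite /E' eqxx.
    move=> h; split; first by move=> k ku; apply: h; rewrite /= inE ku orbT.
    by have := h i; rewrite /E' eqxx; apply; rewrite /= mem_head.
  rewrite XE XB !indF ?undup_uniq//; last 2 first.
  - by move=> k ku; apply: FE'; rewrite inE ku orbT.
  - by rewrite /= undup_uniq mem_undup si.
  by rewrite big_cons {1}/E' eqxx.
have := @g_sigma_algebra_measure_unique _ _ _ C mC (fun=> setT) (fun=> CT)
  _ (mrestr P mB) (mscale (NngNum PB0) P) CI.
rewrite muleC => uniq_measure.
have msE Y : mscale (NngNum PB0) P Y = (P B * P Y)%E by rewrite -[in RHS]EB.
suff : mrestr P mB A = mscale (NngNum PB0) P A by rewrite msE.
apply: uniq_measure => //.
- by apply/seteqP; split => // w _; exists 0%N.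
- by move=> X CX; exact: (etrans (key _ CX) (esym (msE X))).
- move=> _; apply: (@le_lt_trans _ _ (P (setT `&` B))) => //.
  by rewrite setTI (le_lt_trans (probability_le1 _ _))// ltry.
Qed.

End independence.

(** * Square-integrable random vectors *)

Section square_integrable.
Local Open Scope classical_set_scope.
Context {dO : measure_display} {Omega : measurableType dO} {R : realType}.
Variable P : probability Omega R.
Implicit Types X Y : Omega -> R.

Definition L1 X := P.-integrable setT (EFin \o X).
Definition Ex X : R := (\int[P]_w X w)%R.

Lemma L1_le X Y : measurable_fun setT X -> L1 Y -> (forall w, `|X w| <= Y w) ->
  L1 X.
Proof.
move=> mX iY XY; apply: le_integrable iY => //.
  exact/measurable_EFinP.
move=> w _ /=; rewrite lee_fin.
by rewrite (le_trans (XY w))// ler_norm.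
Qed.

Lemma L1_cst (c : R) : L1 (fun=> c).
Proof. by apply: finite_measure_integrable_cst. Qed.

Lemma L1D X Y : L1 X -> L1 Y -> L1 (fun w => X w + Y w).
Proof. by move=> iX iY; have := integrableD measurableT iX iY. Qed.

Lemma L1Z (k : R) X : L1 X -> L1 (fun w => k * X w).
Proof. by move=> iX; have := integrableZl measurableT k iX. Qed.

Lemma L1B X Y : L1 X -> L1 Y -> L1 (fun w => X w - Y w).
Proof. by move=> iX iY; have := integrableB measurableT iX iY. Qed.

Lemma L1_sum (I : Type) (r : seq I) (X : I -> Omega -> R) :
  (forall i, L1 (X i)) -> L1 (fun w => \sum_(i <- r) X i w).
Proof.
move=> iX; elim: r => [|i r IH].
  by under eq_fun do rewrite big_nil; exact: L1_cst.
by under eq_fun do rewrite big_cons; exact: L1D.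
Qed.

Lemma expectationE X : L1 X -> ('E_P[X] = (Ex X)%:E)%E.
Proof. by move=> iX; rewrite unlock fineK// integrable_fin_num. Qed.

Lemma Ex_cst (c : R) : Ex (fun=> c) = c.
Proof. by rewrite /Ex Rintegral_cst//= probability_setT mulr1. Qed.

Lemma ExD X Y : L1 X -> L1 Y -> Ex (fun w => X w + Y w) = Ex X + Ex Y.
Proof. by move=> iX iY; exact: RintegralD. Qed.

Lemma ExB X Y : L1 X -> L1 Y -> Ex (fun w => X w - Y w) = Ex X - Ex Y.
Proof. by move=> iX iY; exact: RintegralB. Qed.

Lemma ExZ (k : R) X : L1 X -> Ex (fun w => k * X w) = k * Ex X.
Proof. by move=> iX; exact: RintegralZl. Qed.

Lemma Ex_sum (I : Type) (r : seq I) (X : I -> Omega -> R) :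
  (forall i, L1 (X i)) ->
  Ex (fun w => \sum_(i <- r) X i w) = \sum_(i <- r) Ex (X i).
Proof.
move=> iX; elim: r => [|i r IH].
  by rewrite big_nil -[RHS](Ex_cst 0); congr Ex; apply/funext => w;
    rewrite big_nil.
rewrite big_cons -IH -ExD//; last exact: L1_sum.
by congr Ex; apply/funext => w; rewrite big_cons.
Qed.

Lemma Ex_le X Y : L1 X -> L1 Y -> (forall w, X w <= Y w) -> Ex X <= Ex Y.
Proof. by move=> iX iY XY; apply: le_Rintegral. Qed.

Lemma Ex_ge0 X : (forall w, 0 <= X w) -> 0 <= Ex X.
Proof. by move=> X0; apply: Rintegral_ge0. Qed.

Definition L2 X := measurable_fun setT X /\ L1 (fun w => X w ^+ 2).

Lemma L1_mul X Y : L2 X -> L2 Y -> L1 (fun w => X w * Y w).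
Proof.
move=> [mX iX] [mY iY]; apply: L1_le (L1D iX iY) _; first exact: measurable_funM.
move=> w; rewrite normrM -(real_normK (num_real (X w))).
rewrite -(real_normK (num_real (Y w))).
by have := sqr_ge0 (`|X w| - `|Y w|); have := sqr_ge0 (`|X w| + `|Y w|); nra.
Qed.

Lemma L2D X Y : L2 X -> L2 Y -> L2 (fun w => X w + Y w).
Proof.
move=> hX hY; split; first by apply: measurable_funD; [case: hX|case: hY].
rewrite (_ : (fun w => _) =
    fun w => X w ^+ 2 + (2 * (X w * Y w) + Y w ^+ 2)).
  by apply: L1D hX.2 _; apply: L1D _ hY.2; apply: L1Z; exact: L1_mul.
by apply/funext => w; ring.
Qed.

Lemma L2Z (k : R) X : L2 X -> L2 (fun w => k * X w).
Proof.
move=> hX; split; first by apply: measurable_funM => //; case: hX.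
under eq_fun do rewrite exprMn.
exact: L1Z hX.2.
Qed.

Lemma L2_cst (c : R) : L2 (fun=> c).
Proof. by split => //; exact: L1_cst. Qed.

Lemma L2_L1 X : L2 X -> L1 X.
Proof.
move=> hX; have := L1_mul hX (L2_cst 1).
by under eq_fun do rewrite mulr1.
Qed.

Variable d : nat.
Implicit Types U V W : Omega -> 'rV[R]_d.

Definition L2v V := forall i, L2 (fun w => V w 0 i).

Lemma L2vD U V : L2v U -> L2v V -> L2v (fun w => U w + V w).
Proof. by move=> hU hV i; under eq_fun do rewrite mxE; exact: L2D. Qed.

Lemma L2vZ (k : R) V : L2v V -> L2v (fun w => k *: V w).
Proof. by move=> hV i; under eq_fun do rewrite mxE; exact: L2Z. Qed.

Lemma L2vN V : L2v V -> L2v (fun w => - V w).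
Proof. by move=> hV; under eq_fun do rewrite -scaleN1r; exact: L2vZ. Qed.

Lemma L2vB U V : L2v U -> L2v V -> L2v (fun w => U w - V w).
Proof. by move=> hU hV; apply: L2vD => //; exact: L2vN. Qed.

Lemma L2v_cst (v : 'rV[R]_d) : L2v (fun=> v).
Proof. by move=> i; exact: L2_cst. Qed.

Lemma L2v_sum (I : Type) (r : seq I) (V : I -> Omega -> 'rV[R]_d) :
  (forall i, L2v (V i)) -> L2v (fun w => \sum_(i <- r) V i w).
Proof.
move=> iV; elim: r => [|i r IH].
  by under eq_fun do rewrite big_nil; exact: L2v_cst.
by under eq_fun do rewrite big_cons; exact: L2vD.
Qed.

Lemma L1_dot U V : L2v U -> L2v V -> L1 (fun w => dot (U w) (V w)).
Proof. by move=> hU hV; apply: L1_sum => i; exact: L1_mul. Qed.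

Lemma L1_sqnorm V : L2v V -> L1 (fun w => sqnorm (V w)).
Proof. by move=> hV; under eq_fun do rewrite sqnormE; exact: L1_dot. Qed.

Lemma L2v_le V Y : (forall i, measurable_fun setT (fun w => V w 0 i)) -> L1 Y ->
  (forall w, sqnorm (V w) <= Y w) -> L2v V.
Proof.
move=> mV iY VY i; split => //; apply: L1_le iY _.
  exact: measurable_funX.
move=> w; rewrite ger0_norm ?sqr_ge0//; apply: le_trans (VY w).
by rewrite /sqnorm (bigD1 i)//= lerDl; apply: sumr_ge0 => j _; exact: sqr_ge0.
Qed.

Lemma Ex_sqnorm_orth (I : finType) (V : I -> Omega -> 'rV[R]_d) :
  (forall i, L2v (V i)) ->
  (forall i j, i != j -> Ex (fun w => dot (V i w) (V j w)) = 0) ->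
  Ex (fun w => sqnorm (\sum_i V i w)) = \sum_i Ex (fun w => sqnorm (V i w)).
Proof.
move=> hV orth.
have -> : (fun w => sqnorm (\sum_i V i w)) =
    fun w => \sum_i \sum_j dot (V i w) (V j w).
  apply/funext => w; rewrite sqnormE dot_suml; apply: eq_bigr => i _.
  by rewrite dot_sumr.
rewrite Ex_sum => [|i]; last by apply: L1_sum => j; exact: L1_dot.
apply: eq_bigr => i _; rewrite Ex_sum => [|j]; last exact: L1_dot.
rewrite (bigD1 i)//= big1 ?addr0 => [|j ji].
  by congr Ex; apply/funext => w; rewrite sqnormE.
by rewrite orth// eq_sym.
Qed.

End square_integrable.

(** * Noise produced by a source independent of the past *)

Section fresh_randomness.
Local Open Scope classical_set_scope.
Context {dO dT : measure_display} {Omega : measurableType dO}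
  {T : measurableType dT} {R : realType}.
Variables (P : probability Omega R) (G : set (set Omega)) (xi : Omega -> T).
Hypotheses (G_measurable : G `<=` measurable) (mxi : measurable_fun setT xi).
Hypothesis indep : forall A B, <<s G >> A -> measurable B ->
  (P (A `&` xi @^-1` B) = P A * P (xi @^-1` B))%E.
Variable d : nat.

Definition adapted (V : Omega -> 'rV[R]_d) :=
  forall i, measurable_fun setT (fun w : g_sigma_algebraType G => V w 0 i).

Definition tuple_of_row (v : 'rV[R]_d) : d.-tuple R := [tuple v 0 i | i < d].

Lemma tuple_of_rowK v : row_of_tuple (tuple_of_row v) = v.
Proof. by apply/rowP => i; rewrite mxE tnth_mktuple. Qed.

Lemma measurable_tuple_of_row d' (S : measurableType d') (V : S -> 'rV[R]_d) :
  (forall i, measurable_fun setT (fun s => V s 0 i)) ->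
  measurable_fun setT (fun s => tuple_of_row (V s)).
Proof.
move=> mV; apply/measurable_fun_tnthP => i.
rewrite (_ : _ \o _ = fun s => V s 0 i)//.
by apply/funext => s /=; rewrite tnth_mktuple.
Qed.

Let sub_sigma : <<s G >> `<=` measurable.
Proof. by apply: smallest_sub => //; exact: sigma_algebra_measurable. Qed.

Lemma adapted_measurable (V : Omega -> 'rV[R]_d) i :
  adapted V -> measurable_fun setT (fun w => V w 0 i).
Proof. by move=> aV _ B mB; apply: sub_sigma; exact: aV. Qed.

(** Two instances are needed. For mini-batch gradients [h] is the gradient, a = sigma^2 and b = 0;
    for compression [h] is the identity, a = 0 and b = q. *)
Variables (Phi : 'rV[R]_d -> T -> 'rV[R]_d) (h : 'rV[R]_d -> 'rV[R]_d).
Variables (a b : R).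
Hypothesis mPhi : forall i, measurable_fun setT
  (fun p : d.-tuple R * T => Phi (row_of_tuple p.1) p.2 0 i).
Hypothesis mh : forall i, measurable_fun setT
  (fun t : d.-tuple R => h (row_of_tuple t) 0 i).
Hypothesis unbiased : forall x i,
  ('E_P[fun w => Phi x (xi w) 0%R i] = (h x 0%R i)%:E)%E.
Hypothesis variance_le : forall x,
  ('E_P[fun w => sqnorm (Phi x (xi w) - h x)%R] <= (a + b * sqnorm x)%:E)%E.

Lemma measurable_Phi d' (S : measurableType d') (V : S -> 'rV[R]_d) (z : S -> T)
    i :
  (forall i, measurable_fun setT (fun s => V s 0 i)) -> measurable_fun setT z ->
  measurable_fun setT (fun s => Phi (V s) (z s) 0 i).
Proof.
move=> mV mz; under eq_fun do rewrite -[V _]tuple_of_rowK.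
apply: (measurableT_comp (mPhi i)
  (measurable_fun_pair (measurable_tuple_of_row mV) mz)).
Qed.

Lemma measurable_h d' (S : measurableType d') (V : S -> 'rV[R]_d) i :
  (forall i, measurable_fun setT (fun s => V s 0 i)) ->
  measurable_fun setT (fun s => h (V s) 0 i).
Proof.
move=> mV; under eq_fun do rewrite -[V _]tuple_of_rowK.
exact: (measurableT_comp (mh i) (measurable_tuple_of_row mV)).
Qed.

Lemma L1_ge0_lty (X : Omega -> R) : measurable_fun setT X ->
  (forall w, 0 <= X w) -> (\int[P]_w (X w)%:E < +oo)%E -> L1 P X.
Proof.
move=> mX X0 fin; apply/integrableP; split; first exact/measurable_EFinP.
apply: le_lt_trans fin; apply: ge0_le_integral => //.
- by apply: measurableT_comp => //; exact/measurable_EFinP.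
- exact/measurable_EFinP.
- by move=> w _; rewrite /= ger0_norm.
Qed.

Lemma frozen_L2 x : L2v P (fun w => Phi x (xi w) - h x).
Proof.
apply: (@L2v_le _ _ _ _ _ _ (fun w => sqnorm (Phi x (xi w) - h x))) => //.
- move=> i; under eq_fun do rewrite mxE [X in _ + X]mxE.
  by apply: measurable_funD => //; exact: measurable_Phi.
- apply: L1_ge0_lty.
  + apply: measurable_sum => i; apply: measurable_funX.
    under eq_fun do rewrite mxE [X in _ + X]mxE.
    by apply: measurable_funD => //; exact: measurable_Phi.
  + by move=> w; exact: sqnorm_ge0.
  + by have := variance_le x; rewrite unlock => /le_lt_trans; apply; exact: ltry.
Qed.

Variable Y : Omega -> 'rV[R]_d.
Hypotheses (aY : adapted Y) (L2Y : L2v P Y).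

Let N w := Phi (Y w) (xi w) - h (Y w).

Let mid : @measurable_fun _ _ Omega (g_sigma_algebraType G) setT id.
Proof. by move=> _ B mB; rewrite setTI; exact: sub_sigma. Qed.

Lemma noise_measurable i : measurable_fun setT (fun w => N w 0 i).
Proof.
under eq_fun do rewrite mxE [X in _ + X]mxE.
apply: measurable_funD.
  by apply: measurable_Phi => // j; exact: adapted_measurable.
apply: measurableT_comp => //.
by apply: measurable_h => // j; exact: adapted_measurable.
Qed.

(** The identity map into Omega with the sigma-algebra generated by [G]: freezing it freezes every
    adapted vector at once, and its independence from [X2] is the hypothesis [indep]. *)
Let X1 : {mfun Omega >-> g_sigma_algebraType G} :=
  HB.pack (id : Omega -> g_sigma_algebraType G)
    (isMeasurableFun.Build _ _ Omega (g_sigma_algebraType G) id mid).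
Let X2 : {mfun Omega >-> T} :=
  HB.pack xi (isMeasurableFun.Build _ _ Omega T xi mxi).

Let measurable_N i :
  measurable_fun setT (fun p : g_sigma_algebraType G * T =>
    (Phi (Y p.1) p.2 - h (Y p.1)) 0 i).
Proof.
under eq_fun do rewrite mxE [X in _ + X]mxE.
have mY1 j : measurable_fun setT (fun p : g_sigma_algebraType G * T => Y p.1 0 j).
  exact: (measurableT_comp (aY j) measurable_fst).
apply: measurable_funD; first exact: measurable_Phi.
by apply: measurableT_comp => //; exact: measurable_h.
Qed.

Let L1_bound : L1 P (fun w => a + b * sqnorm (Y w)).
Proof. by apply: L1D; [exact: L1_cst|apply: L1Z; exact: L1_sqnorm]. Qed.

Let sqnorm_N_le : (\int[P]_w (sqnorm (N w))%:E <=
  \int[P]_w (a + b * sqnorm (Y w))%:E)%E.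
Proof.
apply: (@ge0_freezing_le _ _ _ Omega _ _ R P X1 X2 indep
  (fun p => (sqnorm (Phi (Y p.1) p.2 - h (Y p.1)))%:E)
  (fun w => (a + b * sqnorm (Y w))%:E)).
- apply/measurable_EFinP; apply: measurable_sum => i.
  by apply: measurable_funX; exact: measurable_N.
- by move=> p; rewrite lee_fin sqnorm_ge0.
- apply/measurable_EFinP; apply: measurable_funD => //.
  apply: measurable_funM => //; apply: measurable_sum => i.
  by apply: measurable_funX; exact: aY.
- by move=> w; have := variance_le (Y w); rewrite unlock.
Qed.

(** Only frozen arguments have a variance bound by hypothesis. Freezing turns it into the bound a +
    b E|Y|^2 at the random argument [Y], finite as [Y] is square-integrable. *)
Lemma noise_L2 : L2v P N.
Proof.
apply: (@L2v_le _ _ _ _ _ _ (fun w => sqnorm (N w))) => //.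
- exact: noise_measurable.
apply: L1_ge0_lty.
- by apply: measurable_sum => i; apply: measurable_funX; exact: noise_measurable.
- by move=> w; exact: sqnorm_ge0.
apply: (le_lt_trans sqnorm_N_le).
exact/integrable_lty/L1_bound.
Qed.

Lemma noise_variance :
  Ex P (fun w => sqnorm (N w)) <= a + b * Ex P (fun w => sqnorm (Y w)).
Proof.
have iY := L1_sqnorm L2Y.
have <- : Ex P (fun w => a + b * sqnorm (Y w)) =
    a + b * Ex P (fun w => sqnorm (Y w)).
  rewrite ExD ?ExZ ?Ex_cst//; [exact: L1_cst | exact: L1Z].
rewrite /Ex /Rintegral fine_le// ?integrable_fin_num//.
- exact: L1_sqnorm noise_L2.
Qed.

(** Once the past is frozen, [W] is a constant vector and the noise is centred coordinate by
    coordinate. *)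
Lemma noise_orthogonal (W : Omega -> 'rV[R]_d) : adapted W -> L2v P W ->
  Ex P (fun w => dot (W w) (N w)) = 0.
Proof.
move=> aW L2W.
have iW x : L1 P (fun w => dot (W x) (Phi (Y x) (xi w) - h (Y x))).
  apply: (@L1_dot _ _ _ _ _ (fun=> W x)) (frozen_L2 _).
  exact: L2v_cst.
rewrite /Ex /Rintegral.
have := @freezing0 _ _ _ Omega _ _ R P X1 X2 indep
  (fun p => (dot (W p.1) (Phi (Y p.1) p.2 - h (Y p.1)))%:E) _ _ _ _.
move=> ->//.
- apply/measurable_EFinP; apply: measurable_sum => i.
  apply: measurable_funM => //.
  exact: (measurableT_comp (aW i) measurable_fst).
- exact: L1_dot L2W noise_L2.
- move=> x; have fx := frozen_L2 (Y x).
  have E : Ex P (fun w => dot (W x) (Phi (Y x) (xi w) - h (Y x))) = 0.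
    rewrite /dot Ex_sum => [|i]; last first.
      by apply: L1Z; exact: L2_L1 (fx i).
    apply: big1 => i _; rewrite ExZ; last exact: L2_L1 (fx i).
    have iPhi : L1 P (fun w => Phi (Y x) (xi w) 0 i).
      have := L1D (L2_L1 (fx i)) (L1_cst P (h (Y x) 0 i)).
      by congr L1; apply/funext => w; rewrite !mxE subrK.
    under eq_fun do rewrite mxE [X in _ + X]mxE.
    rewrite ExB//; last exact: L1_cst.
    have := unbiased (Y x) i; rewrite expectationE// => -[->].
    by rewrite Ex_cst subrr mulr0.
  rewrite -[RHS](congr1 EFin E) /Ex /Rintegral fineK//.
  by apply: integrable_fin_num => //; exact: iW.
Qed.

End fresh_randomness.

(** * One round *)

(** The absorption itself. [EQ] is the second moment of the averaged messages, [Dr] the drift of the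
    local models, [X] the device average of the summed E|grad|^2 at local models. The coefficient of
    s X is at most 5/16 from [EQ] plus 5/32 from [Dr], below the available 1/2. The noise costs 5/2
    + 5/4 <= 4 times L s^2 tau sig2 (1 + q) / m. *)
Lemma residual_le (R : realType) (L s eta gamma tau q m X sig2 EQ Dr : R) :
  0 < L -> 0 <= eta -> s = eta * gamma -> 0 <= tau -> 0 <= q -> 1 <= m ->
  m <= gamma -> 0 <= X -> 0 <= sig2 -> L * s * tau * (1 + q / m) <= 2^-1 ->
  EQ <= 5 / 4 * tau * X * (1 + q / m) + 5 * tau * sig2 * (1 + q) / m ->
  Dr <= eta ^+ 2 * tau ^+ 2 * (5 / 4 * X + 5 * sig2) ->
  L / 2 * s ^+ 2 * EQ + s / 2 * L ^+ 2 * Dr - s / 2 * X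
    <= 4 * L * s ^+ 2 * tau * sig2 * (1 + q) / m.
Proof.
move=> L0 eta0 sE tau0 q0 m1 mg X0 sig0 u2 hQ hD.
have m0 : 0 < m by lra.
have g0 : 0 < gamma by lra.
have s0 : 0 <= s by rewrite sE mulr_ge0// ltW.
pose r := q / m; have r0 : 0 <= r by rewrite divr_ge0// ltW.
pose p := (1 + q) / m; have p0 : 0 <= p by rewrite divr_ge0 ?addr_ge0// ltW.
have pm : m^-1 <= p by rewrite ler_pdivlMr// mulVf ?gt_eqF//; lra.
(* The drift is controlled by [y], and y gamma = L s tau <= 1/2. Since gamma >= m >= 1, this gives y
   <= 1/2. *)
pose y := L * eta * tau.
have y0 : 0 <= y by rewrite !mulr_ge0// ltW.
have Ls : 0 <= L * s * tau by rewrite !mulr_ge0// ltW.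
have yg : y * gamma <= 2^-1.
  have -> : y * gamma = L * s * tau by rewrite sE /y; ring.
  by apply: le_trans u2; rewrite ler_peMr// lerDl.
have ym : y * m <= 2^-1 by apply: le_trans yg; rewrite ler_wpM2l.
have y2 : y <= 2^-1 by apply: le_trans ym; rewrite ler_peMr.
have yy : y ^+ 2 <= 4^-1 by nra.
have sy : s * y ^+ 2 <= L * s ^+ 2 * tau * p / 2.
  have -> : s * y ^+ 2 = L * s * tau * eta * y by rewrite /y; ring.
  (* Here gamma >= m is essential: eta y <= eta / (2 gamma) <= eta gamma / (2 m), because gamma^2 >=
     m, and 1 / m <= p. *)
  have ey : eta * y <= s * (p / 2).
    have : eta * y * gamma <= eta * gamma * (m^-1 / 2) * gamma.
      have -> : eta * y * gamma = eta * (y * gamma) by ring.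
      have : 2^-1 <= gamma * (m^-1 / 2) * gamma.
        have gm : 1 <= gamma / m by rewrite ler_pdivlMr// mul1r.
        have -> : gamma * (m^-1 / 2) * gamma = gamma / m * gamma / 2 by ring.
        by nra.
      move=> /(le_trans yg) h.
      have -> : eta * gamma * (m^-1 / 2) * gamma =
                eta * (gamma * (m^-1 / 2) * gamma) by ring.
      by rewrite ler_wpM2l.
    rewrite ler_pM2r// => /le_trans; apply; rewrite -sE ler_wpM2l//.
    lra.
  rewrite -mulrA (_ : L * s ^+ 2 * tau * p / 2 = L * s * tau * (s * (p / 2))).
    by rewrite ler_wpM2l.
  by rewrite expr2; ring.
have hQ' : L / 2 * s ^+ 2 * EQ <=
    s / 2 * (5 / 4 * X) * (L * s * tau * (1 + r))
    + 5 / 2 * (L * s ^+ 2 * tau * sig2 * p).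
  have -> : s / 2 * (5 / 4 * X) * (L * s * tau * (1 + r))
    + 5 / 2 * (L * s ^+ 2 * tau * sig2 * p)
    = L / 2 * s ^+ 2 * (5 / 4 * tau * X * (1 + r) + 5 * tau * sig2 * p).
    by field.
  rewrite ler_wpM2l ?mulr_ge0 ?sqr_ge0 ?invr_ge0 ?(ltW L0)//.
  by apply: le_trans hQ _; rewrite /r /p [_ * ((1 + q) / m)]mulrA.
have hD' : s / 2 * L ^+ 2 * Dr <= s / 2 * y ^+ 2 * (5 / 4 * X + 5 * sig2).
  have -> : s / 2 * y ^+ 2 * (5 / 4 * X + 5 * sig2) =
    s / 2 * L ^+ 2 * (eta ^+ 2 * tau ^+ 2 * (5 / 4 * X + 5 * sig2)).
    by rewrite /y; ring.
  by rewrite ler_wpM2l//; apply: mulr_ge0; [lra|exact: sqr_ge0].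
have sX : 0 <= s * X by rewrite mulr_ge0.
have h1 : s / 2 * (5 / 4 * X) * (L * s * tau * (1 + r))
          <= s / 2 * (5 / 4 * X) * 2^-1.
  by rewrite ler_wpM2l//; lra.
have h2 : s / 2 * X * (5 / 4) * y ^+ 2 <= s / 2 * X * (5 / 4) * 4^-1.
  by rewrite ler_wpM2l//; lra.
have h3 : s * y ^+ 2 * sig2 <= L * s ^+ 2 * tau * p / 2 * sig2.
  by rewrite ler_wpM2r.
have T0 : 0 <= L * s ^+ 2 * tau * sig2 * p.
  have -> : L * s ^+ 2 * tau * sig2 * p = L * s * tau * (s * sig2 * p) by ring.
  by rewrite mulr_ge0// mulr_ge0// mulr_ge0.
rewrite -[4 * L * s ^+ 2 * tau * sig2 * (1 + q) / m]mulrA -/p.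
lra.
Qed.

Section one_round.
Local Open Scope classical_set_scope.
Context {dO : measure_display} {Omega : measurableType dO} {R : realType}.
Variables (P : probability Omega R) (m d tau : nat).
Variables (L sig2 q eta gamma : R) (f : 'rV[R]_d -> R).
Hypotheses (m_gt0 : (0 < m)%N) (L0 : 0 < L) (sf : smooth L f).
Hypotheses (q0 : 0 <= q) (eta0 : 0 <= eta) (m_gamma : m%:R <= gamma).
Hypothesis sig0 : 0 <= sig2.
(** An abstract round: [w] is the server model, [v j c] the local models, [n j c] the mini-batch
    noise and [e j] the compression noise. The two noises enter only through moments and
    orthogonality relations. *)
Variables (w : Omega -> 'rV[R]_d) (v n : 'I_m -> nat -> Omega -> 'rV[R]_d).
Variable (e : 'I_m -> Omega -> 'rV[R]_d).
Let g j c omega := grad f (v j c omega).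
Hypothesis vE : forall j c omega,
  v j c omega = w omega - eta *: \sum_(k < c) (g j k omega + n j k omega).
Hypotheses (L2w : L2v P w) (L2n : forall j c, L2v P (n j c)).
Hypothesis L2e : forall j, L2v P (e j).
Local Notation E := (Ex P).
Hypothesis n_var : forall j c, E (fun o => sqnorm (n j c o)) <= sig2.
Hypothesis n_orth : forall j c k c', (j, c) != (k, c') ->
  E (fun o => dot (n j c o) (n k c' o)) = 0.
Let D j omega := \sum_(c < tau) (g j c omega + n j c omega).
Hypothesis e_var : forall j,
  E (fun o => sqnorm (e j o)) <= q * E (fun o => sqnorm (D j o)).
Hypothesis e_orth : forall j k, j != k -> E (fun o => dot (e j o) (e k o)) = 0.
Hypothesis e_orthD : forall j k, E (fun o => dot (D j o) (e k o)) = 0.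
Let s := eta * gamma.
Let Qb omega := m%:R^-1 *: \sum_j (D j omega + e j omega).

Lemma L2v_grad V : L2v P V -> L2v P (fun o => grad f (V o)).
Proof.
move=> hV; apply: (@L2v_le _ _ _ _ _ _
  (fun o => 2 * (L ^+ 2 * sqnorm (V o)) + 2 * sqnorm (grad f 0))).
- move=> i; apply: (@measurable_h _ _ (grad f)).
    by move=> j; exact: measurable_grad L0 sf _.
  by move=> j; case: (hV j).
- by apply: L1D; [apply/L1Z/L1Z/L1_sqnorm|exact: L1_cst].
- move=> o; rewrite -[X in sqnorm X](subrK (grad f 0)).
  apply: le_trans (sqnormD_le2 _ _) _; rewrite lerD2r ler_pM2l//.
  by apply: le_trans (grad_lip L0 sf _ _) _; rewrite subr0.
Qed.

Let L2v_vg j c : L2v P (v j c) /\ L2v P (g j c).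
Proof.
suff h : L2v P (v j c) by split => //; exact: L2v_grad.
elim/ltn_ind: c => c IH.
rewrite (_ : v j c = fun o => w o - eta *: \sum_(k < c) (g j k o + n j k o)).
  apply: L2vB => //; apply: L2vZ.
  apply: L2v_sum => k; apply: L2vD => //.
  by apply: L2v_grad; exact: IH.
by apply/funext => o; exact: vE.
Qed.

Let L2v_v j c := (L2v_vg j c).1.
Let L2v_g j c := (L2v_vg j c).2.

Let L2v_D j : L2v P (D j).
Proof. by apply: L2v_sum => c; exact: L2vD. Qed.

Lemma L2v_Qb : L2v P Qb.
Proof. by apply: L2vZ; apply: L2v_sum => j; exact: L2vD. Qed.

Let x j c := E (fun o => sqnorm (g j c o)).
Let x_ge0 j c : 0 <= x j c.
Proof. by apply: Ex_ge0 => o; exact: sqnorm_ge0. Qed.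

(** The index set is abstract so that one bound serves the partial sums of a single device and the
    double sum over all devices. Injectivity of [u] makes the summed noises pairwise orthogonal,
    whence a factor #|A| and not its square. *)
Let n_sum (A : finType) (u : A -> 'I_m * nat) : injective u ->
  E (fun o => sqnorm (\sum_a n (u a).1 (u a).2 o)) <= #|A|%:R * sig2.
Proof.
move=> inj; rewrite Ex_sqnorm_orth => [||a b ab]; last 2 first.
- by move=> a; exact: L2n.
- by apply: n_orth; rewrite -!surjective_pairing (inj_eq inj).
apply: (@le_trans _ _ (\sum_(a : A) sig2)); first exact: ler_sum.
by rewrite sumr_const mulr_natl.
Qed.

Let gn_sum (A : finType) (u : A -> 'I_m * nat) : injective u ->
  E (fun o => sqnorm (\sum_a (g (u a).1 (u a).2 o + n (u a).1 (u a).2 o)))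
  <= 5 / 4 * #|A|%:R * \sum_a x (u a).1 (u a).2 + 5 * #|A|%:R * sig2.
Proof.
move=> inj.
have L2G : L2v P (fun o => \sum_a g (u a).1 (u a).2 o).
  by apply: L2v_sum => a; exact: L2v_g.
have L2N : L2v P (fun o => \sum_a n (u a).1 (u a).2 o).
  by apply: L2v_sum => a; exact: L2n.
have L1G : L1 P (fun o => #|A|%:R * \sum_a sqnorm (g (u a).1 (u a).2 o)).
  by apply/L1Z/L1_sum => a; apply: L1_sqnorm; exact: L2v_g.
apply: (@le_trans _ _ (E (fun o =>
    5 / 4 * (#|A|%:R * \sum_a sqnorm (g (u a).1 (u a).2 o)) +
    5 * sqnorm (\sum_a n (u a).1 (u a).2 o)))).
  apply: Ex_le => [||o].
  - by apply: L1_sqnorm; apply: L2v_sum => a; apply: L2vD; [exact: L2v_g|].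
  - by apply: L1D; apply: L1Z => //; exact: L1_sqnorm.
  - rewrite big_split; apply: le_trans (sqnormD_young _ _) _.
    by rewrite lerD2r ler_pM2l//; exact: sqnorm_sum_le.
rewrite ExD ?ExZ//; last 4 first.
- by apply: L1_sum => a; apply: L1_sqnorm; exact: L2v_g.
- exact: L1_sqnorm.
- exact: L1Z.
- by apply: L1Z; exact: L1_sqnorm.
rewrite Ex_sum => [|a]; last by apply: L1_sqnorm; exact: L2v_g.
by rewrite -!mulrA lerD2l ler_pM2l//; exact: n_sum.
Qed.

Let XX := \sum_j \sum_(c < tau) x j c.
Let mR : 0 < m%:R :> R. Proof. by rewrite ltr0n. Qed.

(** The bound is made independent of [c], so that it serves every local model in the drift as well
    as the full sum [D j] fed to the compressor. *)
Let partial_sum j c : (c <= tau)%N ->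
  E (fun o => sqnorm (\sum_(k < c) (g j k o + n j k o)))
  <= 5 / 4 * tau%:R * \sum_(k < tau) x j k + 5 * tau%:R * sig2.
Proof.
move=> ct; have inj : injective (fun k : 'I_c => (j, val k)).
  by move=> a b [] /val_inj.
apply: (le_trans (gn_sum inj)); rewrite card_ord /=.
have ctR : c%:R <= tau%:R :> R by rewrite ler_nat.
have le_sum : \sum_(k < c) x j k <= \sum_(k < tau) x j k.
  rewrite (big_ord_widen _ (x j) ct) [leRHS](bigID (fun k : 'I_tau => k < c)%N) /=.
  by rewrite lerDl sumr_ge0.
apply: lerD; last by rewrite ler_wpM2r// ler_pM2l.
have s0 : 0 <= \sum_(k < c) x j k by exact: sumr_ge0.
by apply: ler_pM => //; rewrite ler_pM2l.
Qed.

Let sum_D_le : E (fun o => sqnorm (\sum_j D j o)) <=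
  5 / 4 * (m%:R * tau%:R) * XX + 5 * (m%:R * tau%:R) * sig2.
Proof.
have inj : injective (fun a : 'I_m * 'I_tau => (a.1, val a.2)).
  by move=> [a1 a2] [b1 b2] [] -> /val_inj ->.
have := gn_sum inj; rewrite card_prod !card_ord natrM /=.
rewrite /XX pair_big /=; congr (E _ <= _); apply/funext => o.
by rewrite pair_big.
Qed.

Let L2v_sumD : L2v P (fun o => \sum_j D j o). Proof. exact: L2v_sum. Qed.
Let L2v_sume : L2v P (fun o => \sum_j e j o). Proof. exact: L2v_sum. Qed.

Let E_dot_sum (U V : 'I_m -> Omega -> 'rV[R]_d) :
  (forall j, L2v P (U j)) -> (forall j, L2v P (V j)) ->
  E (fun o => dot (\sum_j U j o) (\sum_j V j o)) =
  \sum_j \sum_k E (fun o => dot (U j o) (V k o)).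
Proof.
move=> hU hV.
have -> : (fun o => dot (\sum_j U j o) (\sum_j V j o)) =
    fun o => \sum_j \sum_k dot (U j o) (V k o).
  by apply/funext => o; rewrite dot_suml; apply: eq_bigr => j _; rewrite dot_sumr.
rewrite Ex_sum => [|j]; last by apply: L1_sum => k; exact: L1_dot.
by apply: eq_bigr => j _; rewrite Ex_sum => [|k]//; exact: L1_dot.
Qed.

Let X := XX / m%:R.

(** The compression noises are orthogonal to each other and to every [D j], so their second moments
    add up and the compression costs only q / m times the gradient part. On the noise part the two
    contributions combine into (1 + q) / m. *)
Lemma sqnorm_Qb_le : E (fun o => sqnorm (Qb o)) <=
  5 / 4 * tau%:R * X * (1 + q / m%:R) + 5 * tau%:R * sig2 * (1 + q) / m%:R.
Proof.
have -> : (fun o => sqnorm (Qb o)) = fun o => m%:R^-1 ^+ 2 *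
    (sqnorm (\sum_j D j o) + (2 * dot (\sum_j D j o) (\sum_j e j o)
     + sqnorm (\sum_j e j o))).
  apply/funext => o; rewrite /Qb sqnormZ big_split; congr (_ * _).
  by rewrite [LHS]sqnormE !dotE -!sqnormE (dotC (\sum_j e j o)); ring.
have iD := L1_sqnorm L2v_sumD; have ie := L1_sqnorm L2v_sume.
have iDe := L1_dot L2v_sumD L2v_sume.
rewrite ExZ ?ExD ?ExZ//; last 3 first.
- exact: L1Z.
- by apply: L1D => //; exact: L1Z.
- by apply: L1D => //; apply: L1D => //; exact: L1Z.
rewrite (E_dot_sum L2v_D L2e) big1 => [|j _]; last by apply: big1 => k _; exact: e_orthD.
rewrite mulr0 add0r Ex_sqnorm_orth//.
have e_le : \sum_j E (fun o => sqnorm (e j o)) <=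
    q * (5 / 4 * tau%:R * XX + 5 * (m%:R * tau%:R) * sig2).
  apply: (@le_trans _ _ (\sum_j
      q * (5 / 4 * tau%:R * \sum_(k < tau) x j k + 5 * tau%:R * sig2))).
    apply: ler_sum => j _; apply: (le_trans (e_var j)); rewrite ler_wpM2l//.
    exact: partial_sum.
  rewrite -mulr_sumr big_split /= -mulr_sumr sumr_const card_ord -/XX.
  by rewrite -[_ *+ m]mulr_natl (_ : m%:R * _ = 5 * (m%:R * tau%:R) * sig2)//; ring.
apply: (@le_trans _ _ (m%:R^-1 ^+ 2 *
  (5 / 4 * (m%:R * tau%:R) * XX + 5 * (m%:R * tau%:R) * sig2 +
   q * (5 / 4 * tau%:R * XX + 5 * (m%:R * tau%:R) * sig2)))).
  by rewrite ler_wpM2l ?sqr_ge0// lerD.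
by rewrite le_eqVlt /X; apply/orP; left; apply/eqP; field; rewrite gt_eqF.
Qed.

Let drift := m%:R^-1 * \sum_j \sum_(c < tau) E (fun o => sqnorm (w o - v j c o)).

Lemma drift_le :
  drift <= eta ^+ 2 * tau%:R ^+ 2 * (5 / 4 * X + 5 * sig2).
Proof.
have h j (c : 'I_tau) : E (fun o => sqnorm (w o - v j c o)) <=
    eta ^+ 2 * (5 / 4 * tau%:R * \sum_(k < tau) x j k + 5 * tau%:R * sig2).
  have -> : (fun o => sqnorm (w o - v j c o)) =
      fun o => eta ^+ 2 * sqnorm (\sum_(k < c) (g j k o + n j k o)).
    by apply/funext => o; rewrite vE opprB addrC subrK sqnormZ.
  rewrite ExZ; last first.
    by apply: L1_sqnorm; apply: L2v_sum => k; exact: L2vD.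
  by rewrite ler_wpM2l ?sqr_ge0//; apply: partial_sum; exact: ltnW.
rewrite /drift ler_pdivrMl//.
apply: (le_trans (ler_sum _ (fun j _ => ler_sum _ (fun c _ => h j c)))).
under eq_bigr do rewrite sumr_const card_ord -[_ *+ tau]mulr_natl.
rewrite -mulr_sumr -mulr_sumr big_split /= -mulr_sumr sumr_const card_ord.
rewrite -/XX -[_ *+ m]mulr_natl /X.
by rewrite le_eqVlt; apply/orP; left; apply/eqP; field; rewrite gt_eqF.
Qed.

Lemma round_residual : L * s * tau%:R * (1 + q / m%:R) <= 2^-1 ->
  L / 2 * s ^+ 2 * E (fun o => sqnorm (Qb o)) + s / 2 * L ^+ 2 * drift
  - s / 2 * X <= 4 * L * s ^+ 2 * tau%:R * sig2 * (1 + q) / m%:R.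
Proof.
move=> h; apply: (@residual_le _ _ _ eta gamma) => //.
- by rewrite ler1n.
- by apply: divr_ge0; [apply: sumr_ge0 => j _; exact: sumr_ge0|exact: ltW].
- exact: sqnorm_Qb_le.
- exact: drift_le.
Qed.

Lemma dot_Qb V : L2v P V ->
  (forall j c, E (fun o => dot (V o) (n j c o)) = 0) ->
  (forall j, E (fun o => dot (V o) (e j o)) = 0) ->
  E (fun o => dot (V o) (Qb o)) =
  m%:R^-1 * \sum_j \sum_(c < tau) E (fun o => dot (V o) (g j c o)).
Proof.
move=> hV Vn Ve.
have -> : (fun o => dot (V o) (Qb o)) = fun o => m%:R^-1 *
    \sum_j (\sum_(c < tau) (dot (V o) (g j c o) + dot (V o) (n j c o))
            + dot (V o) (e j o)).
  apply/funext => o; rewrite dotZr dot_sumr; congr (_ * _).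
  apply: eq_bigr => j _; rewrite dotDr dot_sumr; congr (_ + _).
  by apply: eq_bigr => c _; rewrite dotDr.
have i1 j : L1 P (fun o => \sum_(c < tau)
    (dot (V o) (g j c o) + dot (V o) (n j c o))).
  by apply: L1_sum => c; apply: L1D; exact: L1_dot.
rewrite ExZ; last by apply: L1_sum => j; apply: L1D => //; exact: L1_dot.
congr (_ * _); rewrite Ex_sum => [|j]; last by apply: L1D => //; exact: L1_dot.
apply: eq_bigr => j _; rewrite ExD//; last exact: L1_dot.
rewrite Ve addr0 Ex_sum => [|c]; last by apply: L1D; exact: L1_dot.
by apply: eq_bigr => c _; rewrite ExD ?Vn ?addr0//; exact: L1_dot.
Qed.

Variable ws : 'rV[R]_d.
Hypothesis ws_min : is_minimizer f ws.
(** Two test fields are used: [grad f] for the descent of the objective, and u - ws for the distance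
    to the minimizer. *)
Hypothesis n_mean0 : forall psi : 'rV[R]_d -> 'rV[R]_d,
  (forall i, measurable_fun setT
    (fun t : d.-tuple R => psi (row_of_tuple t) 0 i)) ->
  L2v P (fun o => psi (w o)) ->
  forall j c, E (fun o => dot (psi (w o)) (n j c o)) = 0.
Hypothesis e_mean0 : forall psi : 'rV[R]_d -> 'rV[R]_d,
  (forall i, measurable_fun setT
    (fun t : d.-tuple R => psi (row_of_tuple t) 0 i)) ->
  L2v P (fun o => psi (w o)) ->
  forall j, E (fun o => dot (psi (w o)) (e j o)) = 0.
Hypothesis s_le : L * s * tau%:R * (1 + q / m%:R) <= 2^-1.
Let noise := 4 * L * s ^+ 2 * tau%:R * sig2 * (1 + q) / m%:R.
Let w' omega := w omega - s *: Qb omega.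
Let s_ge0 : 0 <= s. Proof. by rewrite mulr_ge0// (le_trans _ m_gamma) ?ltW. Qed.

(** The gap lies between 0 and L / 2 |V - ws|^2. *)
Lemma L1_gap V : L2v P V -> L1 P (fun o => f (V o)).
Proof.
move=> hV; have L2d : L2v P (fun o => V o - ws).
  by apply: L2vB => //; exact: L2v_cst.
have : L1 P (fun o => f (V o) - f ws).
  apply: (@L1_le _ _ _ _ _ (fun o => L / 2 * sqnorm (V o - ws))).
  - apply: measurable_funB => //.
    under eq_fun do rewrite -[V _]tuple_of_rowK.
    apply: (measurableT_comp (measurable_smooth sf)).
    by apply: measurable_tuple_of_row => i; case: (hV i).
  - by apply: L1Z; exact: L1_sqnorm.
  - move=> o; rewrite ger0_norm ?subr_ge0 ?ws_min//.
    exact: gap_le L0 sf _ _ ws_min.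
move=> h; have := L1D h (L1_cst P (f ws)).
by under eq_fun do rewrite subrK.
Qed.

(** The averaging step common to descent and distance: each local inner product gains k |grad|^2 and
    loses L^2 k times the squared drift, with k = 1/2 for the descent and k = 1 / (2 L) for the
    distance. *)
Let average_ge (a : R) (b : 'I_m -> nat -> R) (z : 'I_m -> nat -> R) (k : R) :
  (forall j c, a + k * x j c - L ^+ 2 * k * z j c <= b j c) ->
  tau%:R * a + k * X - L ^+ 2 * k * (m%:R^-1 * \sum_j \sum_(c < tau) z j c)
  <= m%:R^-1 * \sum_j \sum_(c < tau) b j c.
Proof.
move=> h; apply: (@le_trans _ _ (m%:R^-1 *
    \sum_j \sum_(c < tau) (a + k * x j c - L ^+ 2 * k * z j c))); last first.
  rewrite ler_pM2l ?invr_gt0//; apply: ler_sum => j _.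
  by apply: ler_sum => c _; exact: h.
have -> : \sum_j \sum_(c < tau) (a + k * x j c - L ^+ 2 * k * z j c) =
    m%:R * (tau%:R * a) + k * XX - L ^+ 2 * k * \sum_j \sum_(c < tau) z j c.
  rewrite /XX !mulr_sumr -[in RHS]sumrN.
  have -> : m%:R * (tau%:R * a) = \sum_(j < m) tau%:R * a.
    by rewrite sumr_const card_ord -[RHS]mulr_natl.
  rewrite -!big_split /=; apply: eq_bigr => j _.
  rewrite !mulr_sumr -sumrN (_ : tau%:R * a = \sum_(c < tau) a).
    by rewrite -!big_split.
  by rewrite sumr_const card_ord -[RHS]mulr_natl.
by rewrite le_eqVlt /X; apply/orP; left; apply/eqP; field; rewrite gt_eqF.
Qed.

Lemma round_descent : E (fun o => f (w' o)) <=
  E (fun o => f (w o)) - s * tau%:R / 2 * E (fun o => sqnorm (grad f (w o)))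
  + noise.
Proof.
have L2g := L2v_grad L2w; have L2Q := L2v_Qb.
have iQ := L1_sqnorm L2Q; have igQ := L1_dot L2g L2Q.
have L2w' : L2v P w' by apply: L2vB => //; exact: L2vZ.
have step : E (fun o => f (w' o)) <= E (fun o => f (w o))
    - s * E (fun o => dot (grad f (w o)) (Qb o))
    + L / 2 * s ^+ 2 * E (fun o => sqnorm (Qb o)).
  rewrite -!ExZ// -ExB ?L1_gap//; last exact: L1Z.
  rewrite -ExD; last 2 first.
  - by apply: L1B; [exact: L1_gap|exact: L1Z].
  - exact: L1Z.
  apply: Ex_le => [||o]; first exact: L1_gap.
    by apply: L1D; [apply: L1B; [exact: L1_gap|exact: L1Z]|exact: L1Z].
  apply: (le_trans (descent L0 sf _ _)).
  by rewrite dotNr sqnormN dotZr sqnormZ mulrA.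
have cross : tau%:R * (2^-1 * E (fun o => sqnorm (grad f (w o)))) + 2^-1 * X
    - L ^+ 2 * 2^-1 * drift <= E (fun o => dot (grad f (w o)) (Qb o)).
  rewrite dot_Qb//; last 2 first.
  - by apply: n_mean0 => // i; exact: measurable_grad L0 sf _.
  - by apply: e_mean0 => // i; exact: measurable_grad L0 sf _.
  apply: (average_ge (b := fun j c => E (fun o => dot (grad f (w o)) (g j c o)))
    (z := fun j c => E (fun o => sqnorm (w o - v j c o)))) => j c.
  have L2d : L2v P (fun o => w o - v j c o) by exact: L2vB.
  have id := L1_sqnorm L2d; have ig := L1_sqnorm L2g.
  have ix := L1_sqnorm (L2v_g j c).
  have iZd := L1Z (L ^+ 2 * 2^-1) id.
  have iZ := L1D (L1Z 2^-1 ig) (L1Z 2^-1 ix).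
  have -> : 2^-1 * E (fun o => sqnorm (grad f (w o))) + 2^-1 * x j c
      - L ^+ 2 * 2^-1 * E (fun o => sqnorm (w o - v j c o)) =
      E (fun o => 2^-1 * sqnorm (grad f (w o)) + 2^-1 * sqnorm (g j c o)
                  - L ^+ 2 * 2^-1 * sqnorm (w o - v j c o)).
    by rewrite (ExB iZ iZd) (ExD (L1Z 2^-1 ig) (L1Z 2^-1 ix)) !ExZ.
  apply: Ex_le => [||o]; [exact: L1B|exact: L1_dot|].
  (* Polarization, 2 <a, b> = |a|^2 + |b|^2 - |a - b|^2, with the last square bounded by the
     Lipschitz property. *)
  have := grad_lip L0 sf (w o) (v j c o).
  rewrite [sqnorm (grad f (w o) - _)]sqnormE !dotE -!sqnormE -/(g j c o).
  by rewrite (dotC (g j c o)); lra.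
have res := round_residual s_le; rewrite -/noise in res.
have : s * (tau%:R * (2^-1 * E (fun o => sqnorm (grad f (w o)))) + 2^-1 * X
    - L ^+ 2 * 2^-1 * drift) <= s * E (fun o => dot (grad f (w o)) (Qb o)).
  by rewrite ler_wpM2l.
by lra.
Qed.

(** [convex_three_points] at each local model replaces polarization, and its nonnegative gap term is
    dropped. The scaling by L / 2 makes the remainder the one bounded in [round_residual]. *)
Lemma round_distance : convex f ->
  L / 2 * E (fun o => sqnorm (w' o - ws)) <=
  L / 2 * E (fun o => sqnorm (w o - ws)) + noise.
Proof.
move=> cf; have L2d : L2v P (fun o => w o - ws).
  by apply: L2vB => //; exact: L2v_cst.
have L2Q := L2v_Qb; have iQ := L1_sqnorm L2Q; have idQ := L1_dot L2d L2Q.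
have id := L1_sqnorm L2d.
have L2w' : L2v P w' by apply: L2vB => //; exact: L2vZ.
have step : E (fun o => sqnorm (w' o - ws)) = E (fun o => sqnorm (w o - ws))
    - 2 * s * E (fun o => dot (w o - ws) (Qb o))
    + s ^+ 2 * E (fun o => sqnorm (Qb o)).
  rewrite -!ExZ// -ExB//; last exact: L1Z.
  rewrite -ExD; [|by apply: L1B => //; exact: L1Z|exact: L1Z].
  congr E; apply/funext => o; rewrite /w' addrAC [LHS]sqnormE.
  move: (w o - ws) (Qb o) => a b.
  by rewrite !dotE -!sqnormE (dotC b a); ring.
have gap_ge0 : 0 <= E (fun o => f (w o) - f ws).
  by apply: Ex_ge0 => o; rewrite subr_ge0 ws_min.
have cross : tau%:R * 0 + (2 * L)^-1 * X
    - L ^+ 2 * (2 * L)^-1 * drift <= E (fun o => dot (w o - ws) (Qb o)).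
  have mpsi i : measurable_fun setT
      (fun t : d.-tuple R => (row_of_tuple t - ws) 0 i).
    under eq_fun do rewrite !mxE.
    by apply: measurable_funB => //; exact: measurable_tnth.
  rewrite dot_Qb//; last 2 first.
  - exact: (n_mean0 (psi := fun u => u - ws) mpsi L2d).
  - exact: (e_mean0 (psi := fun u => u - ws) mpsi L2d).
  apply: (average_ge (b := fun j c => E (fun o => dot (w o - ws) (g j c o)))
    (z := fun j c => E (fun o => sqnorm (w o - v j c o)))) => j c.
  have L2dv : L2v P (fun o => w o - v j c o) by exact: L2vB.
  have idv := L1_sqnorm L2dv.
  have ix := L1_sqnorm (L2v_g j c).
  rewrite add0r -!ExZ//.
  rewrite -ExB//; [|exact: L1Z|exact: L1Z].
  apply: Ex_le => [||o]; first by apply: L1B; exact: L1Z.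
    exact: L1_dot.
  have := convex_three_points L0 sf (w o) (v j c o) cf ws_min.
  rewrite -/(g j c o) dotC.
  rewrite (_ : L ^+ 2 * (2 * L)^-1 = L / 2); last by field; rewrite gt_eqF.
  by have := ws_min (w o); lra.
have res := round_residual s_le; rewrite -/noise in res.
have : L * s * (tau%:R * 0 + (2 * L)^-1 * X - L ^+ 2 * (2 * L)^-1 * drift)
    <= L * s * E (fun o => dot (w o - ws) (Qb o)).
  by rewrite ler_wpM2l// mulr_ge0// ltW.
have -> : L * s * (tau%:R * 0 + (2 * L)^-1 * X - L ^+ 2 * (2 * L)^-1 * drift) =
    s / 2 * X - s / 2 * L ^+ 2 * drift by field; rewrite gt_eqF.
by rewrite step; lra.
Qed.

End one_round.

(** * FedCOM *)

Section adapted_closure.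
Local Open Scope classical_set_scope.
Context {dO : measure_display} {Omega : measurableType dO} {R : realType}.
Variables (G : set (set Omega)) (d : nat).
Implicit Types V W : Omega -> 'rV[R]_d.

Lemma adaptedD V W : adapted G V -> adapted G W ->
  adapted G (fun o => V o + W o).
Proof.
by move=> hV hW i; under eq_fun do rewrite mxE; exact: measurable_funD.
Qed.

Lemma adaptedZ (k : R) V : adapted G V -> adapted G (fun o => k *: V o).
Proof.
by move=> hV i; under eq_fun do rewrite mxE; exact: measurable_funM.
Qed.

Lemma adaptedB V W : adapted G V -> adapted G W ->
  adapted G (fun o => V o - W o).
Proof.
move=> hV hW; apply: adaptedD => //.
by under eq_fun do rewrite -scaleN1r; exact: adaptedZ.
Qed.

Lemma adapted_cst (v : 'rV[R]_d) : adapted G (fun=> v).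
Proof. by move=> i. Qed.

Lemma adapted_sum (I : Type) (r : seq I) (V : I -> Omega -> 'rV[R]_d) :
  (forall i, adapted G (V i)) -> adapted G (fun o => \sum_(i <- r) V i o).
Proof.
move=> hV; elim: r => [|i r IH].
  by under eq_fun do rewrite big_nil; exact: adapted_cst.
by under eq_fun do rewrite big_cons; exact: adaptedD.
Qed.

End adapted_closure.

Section fedcom_analysis.
Local Open Scope classical_set_scope.
Context {R : realType} {m d : nat} (I : fed_instance R m d).
Variables (L sigma q eta gamma : R) (ws : 'rV[R]_d) (tau : nat).
Hypotheses (HI : assumptions I L sigma q ws) (L0 : 0 < L) (eta0 : 0 < eta).

Let P := Pr I.
Let f := objective I.
Let F := @source_events R m d I.
Let m_gt0 := m_gt0 HI.

Lemma objective_local j : f = local_obj I j.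
Proof.
apply/funext => w; rewrite /f /objective (eq_bigr (fun=> local_obj I j w)).
  rewrite sumr_const card_ord -[local_obj I j w *+ m]mulr_natl mulKf//.
  by rewrite pnatr_eq0 -lt0n.
by move=> k _; rewrite /local_obj; have [-> ->] := homog HI k j.
Qed.

Lemma smooth_objective : smooth L f.
Proof. by rewrite (objective_local (Ordinal m_gt0)); exact: local_smooth HI _. Qed.

Lemma source_measurable i : F i `<=` measurable.
Proof.
case: i => [[[j c] r]|[j r]] _ [B mB <-].
  exact: batch_measurable (sampled HI) j c r measurableT B mB.
exact: seed_measurable (sampled HI) j r measurableT B mB.
Qed.

Lemma source_setT i : F i setT.
Proof. by case: i => [[[j c] r]|[j r]]; exists setT; rewrite ?setTI. Qed.

Lemma source_setI i : setI_closed (F i).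
Proof.
case: i => [[[j c] r]|[j r]] _ _ [A mA <-] [B mB <-]; exists (A `&` B);
  rewrite ?setTI//; exact: measurableI.
Qed.

Lemma others_measurable i : others F i `<=` measurable.
Proof. by move=> A [k _]; exact: source_measurable. Qed.

Lemma batch_indep j c r A B : <<s others F (inl (j, c, r)) >> A -> measurable B ->
  (P (A `&` batch j c r @^-1` B) = P A * P (batch j c r @^-1` B))%E.
Proof.
move=> sA mB; apply: (independent_of_others source_measurable source_setT
  source_setI (sources_independent (sampled HI)) sA).
by exists B; rewrite ?setTI.
Qed.

Lemma seed_indep j r A B : <<s others F (inr (j, r)) >> A -> measurable B ->
  (P (A `&` seed j r @^-1` B) = P A * P (seed j r @^-1` B))%E.
Proof.
move=> sA mB; apply: (independent_of_others source_measurable source_setT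
  source_setI (sources_independent (sampled HI)) sA).
by exists B; rewrite ?setTI.
Qed.

Definition knows (G : set (set (Omega I))) i := F i `<=` <<s G >>.

Lemma knows_others i k : k != i -> knows (others F i) k.
Proof. by move=> ki A FA; apply: sub_sigma_algebra; exists k. Qed.

Lemma knows_batch G j c r : knows G (inl (j, c, r)) ->
  measurable_fun setT (batch j c r : g_sigma_algebraType G -> _).
Proof. by move=> kG _ B mB; apply: kG; exists B. Qed.

Lemma knows_seed G j r : knows G (inr (j, r)) ->
  measurable_fun setT (seed j r : g_sigma_algebraType G -> _).
Proof. by move=> kG _ B mB; apply: kG; exists B. Qed.

Lemma adapted_stoch_grad G V j c r : adapted G V -> knows G (inl (j, c, r)) ->
  adapted G (fun o => stoch_grad j (V o) (batch j c r o)).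
Proof.
move=> aV kb i; apply: measurable_Phi => //; last exact: knows_batch.
exact: stoch_grad_measurable (gradients HI) j.
Qed.

Lemma adapted_local G V j r c : adapted G V ->
  (forall c', (c' < c)%N -> knows G (inl (j, c', r))) ->
  adapted G (fun o => local_model eta o j r (V o) c).
Proof.
move=> aV; elim: c => [//|c IH] kb /=.
have aL : adapted G (fun o => local_model eta o j r (V o) c).
  by apply: IH => c' c'c; apply: kb; exact: leqW.
apply: adaptedB => //; apply: adaptedZ; apply: adapted_stoch_grad => //.
exact: kb.
Qed.

Lemma adapted_message G V j r : adapted G V ->
  (forall c', knows G (inl (j, c', r))) -> knows G (inr (j, r)) ->
  adapted G (fun o => message eta tau o j r (V o)).
Proof.
move=> aV kb ks i; apply: measurable_Phi; last exact: knows_seed.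
  exact: Q_measurable (compressed HI).
by apply: adaptedZ; apply: adaptedB => //; exact: adapted_local.
Qed.

Lemma adapted_fedcom G r :
  (forall j c r', (r' < r)%N -> knows G (inl (j, c, r'))) ->
  (forall j r', (r' < r)%N -> knows G (inr (j, r'))) ->
  adapted G (fun o => fedcom eta gamma tau o r).
Proof.
elim: r => [_ _|r IH kb ks]; first exact: adapted_cst.
have aw : adapted G (fun o => fedcom eta gamma tau o r).
  by apply: IH => [j c r' r'r|j r' r'r]; [apply: kb|apply: ks]; exact: leqW.
apply: adaptedB => //; do 2! apply: adaptedZ; apply: adapted_sum => j.
by apply: adapted_message => // [c'|]; [apply: kb|apply: ks].
Qed.

(** * Independence and adaptedness within one actual round *)

Section round.
Variable r : nat.
Let w o := @fedcom R m d I eta gamma tau o r.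
Hypothesis L2w : L2v P w.
Let v j c o := local_model eta o j r (w o) c.
Let n j c o := stoch_grad j (v j c o) (batch j c r o) - grad f (v j c o).
Let D j o := \sum_(c < tau) (grad f (v j c o) + n j c o).
Let e j o := message eta tau o j r (w o) - D j o.
Let bsrc j c : ('I_m * nat * nat) + ('I_m * nat) := inl (j, c, r).
Let ssrc j : ('I_m * nat * nat) + ('I_m * nat) := inr (j, r).

Let vE j c o :
  v j c o = w o - eta *: \sum_(k < c) (grad f (v j k o) + n j k o).
Proof.
elim: c => [|c IH]; first by rewrite big_ord0 scaler0 subr0.
rewrite big_ord_recr /= scalerDr opprD addrA -IH /n addrCA subrr addr0.
by rewrite {1}/v /=.
Qed.

Let DE j o : D j o = eta^-1 *: (w o - v j tau o).
Proof. by rewrite vE opprB addrC subrK scalerK ?gt_eqF. Qed.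

Let w_adapted i : (forall j c r', (r' < r)%N -> i != inl (j, c, r')) ->
  (forall j r', (r' < r)%N -> i != inr (j, r')) -> adapted (others F i) w.
Proof.
move=> ib is_; apply: adapted_fedcom => [j c r' r'r|j r' r'r].
  by apply: knows_others; rewrite eq_sym ib.
by apply: knows_others; rewrite eq_sym is_.
Qed.

Let w_adapted_batch j c : adapted (others F (bsrc j c)) w.
Proof.
apply: w_adapted => [j' c' r' r'r|//]; apply/eqP => -[_ _ rr'].
by rewrite rr' ltnn in r'r.
Qed.

Let w_adapted_seed j : adapted (others F (ssrc j)) w.
Proof.
apply: w_adapted => [//|j' r' r'r]; apply/eqP => -[_ rr'].
by rewrite rr' ltnn in r'r.
Qed.

(** The model of device [k] after c' steps has used only its own batches of index below c', so it
    has not seen batch [c] of device [j]. *)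
Let v_adapted j c k c' : (k != j) || (c' <= c)%N ->
  adapted (others F (bsrc j c)) (v k c').
Proof.
move=> kjc; apply: adapted_local => // c'' c''c'.
apply: knows_others; apply/eqP => -[kj c''c]; move: kjc.
by rewrite kj eqxx /= -c''c leqNgt c''c'.
Qed.

Let grad_adapted (G : set (set (Omega I))) (V : Omega I -> 'rV[R]_d) :
  adapted G V -> adapted G (fun o => grad f (V o)).
Proof.
move=> aV i; apply: (@measurable_h _ _ (grad f)) => // k.
exact: measurable_grad L0 smooth_objective _.
Qed.

Let n_adapted j c k c' : (k != j) || (c' < c)%N ->
  adapted (others F (bsrc j c)) (n k c').
Proof.
move=> kjc; have aV : adapted (others F (bsrc j c)) (v k c').
  by apply: v_adapted; case/orP: kjc => [->//|/ltnW ->]; rewrite orbT.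
apply: adaptedB; last exact: grad_adapted.
apply: adapted_stoch_grad => //; apply: knows_others; apply/eqP => -[kj cc].
by move: kjc; rewrite kj cc eqxx ltnn.
Qed.

Let var_bound j c x :
  ('E_P[fun o => sqnorm (stoch_grad j x (batch j c r o) - grad f x)%R]
   <= (sigma ^+ 2 + 0 * sqnorm x)%:E)%E.
Proof. by rewrite mul0r addr0; exact: stoch_grad_variance (gradients HI) _ _ _ _. Qed.

Let noise_facts j c : L2v P (v j c) -> [/\ L2v P (n j c),
  Ex P (fun o => sqnorm (n j c o)) <= sigma ^+ 2 &
  forall W, adapted (others F (bsrc j c)) W -> L2v P W ->
    Ex P (fun o => dot (W o) (n j c o)) = 0].
Proof.
move=> L2; have aV := @v_adapted j c j c; rewrite leqnn orbT in aV.
have om := @others_measurable (inl (j, c, r)).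
have mb := batch_measurable (sampled HI) j c r.
have mS := stoch_grad_measurable (gradients HI) j.
have mg i := measurable_grad L0 smooth_objective i.
have ind := @batch_indep j c r.
have unb := stoch_grad_unbiased (gradients HI) j c r.
split.
- exact (noise_L2 om mb ind mS mg (var_bound j c) (aV isT) L2).
- have := noise_variance om mb ind mS mg (var_bound j c)
    (aV isT) L2.
  by rewrite mul0r addr0.
- move=> W aW L2W.
  exact (noise_orthogonal om mb ind mS mg unb (var_bound j c)
    (aV isT) L2 aW L2W).
Qed.

(** The induction is interleaved with the noise: the noise at step [k] is square-integrable once the
    model at step [k] is, and the next model is built from both. *)
Let L2v_v j c : L2v P (v j c).
Proof.
elim/ltn_ind: c => c IH.
rewrite (_ : v j c = fun o =>
    w o - eta *: \sum_(k < c) (grad f (v j k o) + n j k o)).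
  apply: L2vB => //; apply: L2vZ; apply: L2v_sum => k; apply: L2vD.
    by apply: L2v_grad smooth_objective _ _; [exact: L0|exact: IH].
  by have [] := noise_facts (IH k (ltn_ord k)).
by apply/funext => o; exact: vE.
Qed.

Let L2v_n j c : L2v P (n j c). Proof. by have [] := noise_facts (L2v_v j c). Qed.

Let n_orth j c k c' : (j, c) != (k, c') ->
  Ex P (fun o => dot (n j c o) (n k c' o)) = 0.
Proof.
(* By symmetry one may order two distinct noises so that n k c' does not involve the batch (j, c).
   It then serves as the adapted test vector against n j c. *)
move=> ne; wlog h : j c k c' ne / (k != j) || (c' < c)%N.
  move=> wl; case: (boolP ((k != j) || (c' < c)%N)) => [|h]; first exact: wl.
  under eq_fun do rewrite dotC; apply: wl; first by rewrite eq_sym.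
  move: h ne; rewrite negb_or negbK -leqNgt => /andP[/eqP -> cc'].
  by rewrite eqxx xpair_eqE eqxx /= ltn_neqAle cc' andbT.
have [_ _ orth] := noise_facts (L2v_v j c).
by under eq_fun do rewrite dotC; apply: orth => //; exact: n_adapted.
Qed.

Let L2v_D j : L2v P (D j).
Proof.
apply: L2v_sum => c; apply: L2vD => //.
exact: L2v_grad L0 smooth_objective _ (L2v_v j c).
Qed.

(** The case j = k is included: before compression, nothing in round [r] has used a seed of that
    round. *)
Let D_adapted j k : adapted (others F (ssrc k)) (D j).
Proof.
rewrite (_ : D j = fun o => eta^-1 *: (w o - v j tau o)).
  apply: adaptedZ; apply: adaptedB => //; apply: adapted_local => // c' _.
  exact: knows_others.
by apply/funext => o; exact: DE.
Qed.

Let eE j : e j = fun o => Q (D j o) (seed j r o) - D j o.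
Proof. by apply/funext => o; rewrite /e /message -DE. Qed.

Let seed_facts j : [/\ L2v P (e j),
  Ex P (fun o => sqnorm (e j o)) <= q * Ex P (fun o => sqnorm (D j o)) &
  forall W, adapted (others F (ssrc j)) W -> L2v P W ->
    Ex P (fun o => dot (W o) (e j o)) = 0].
Proof.
have om := @others_measurable (inr (j, r)).
have ms := seed_measurable (sampled HI) j r.
have mQ := Q_measurable (compressed HI).
have mid i : measurable_fun setT (fun t : d.-tuple R => row_of_tuple t 0 i).
  by under eq_fun do rewrite mxE; exact: measurable_tnth.
have ind := @seed_indep j r.
have unb := Q_unbiased (compressed HI) j r.
have var x : ('E_P[fun o => sqnorm (Q x (seed j r o) - x)%R]
    <= (0 + q * sqnorm x)%:E)%E.
  by rewrite add0r; exact: Q_variance (compressed HI) j r x.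
rewrite eE; split.
- exact (noise_L2 (h := id) om ms ind mQ mid var (@D_adapted j j) (L2v_D j)).
- have := noise_variance (h := id) om ms ind mQ mid var
    (@D_adapted j j) (L2v_D j).
  by rewrite add0r.
- move=> W aW L2W.
  exact (noise_orthogonal (h := id) om ms ind mQ mid unb var
    (@D_adapted j j) (L2v_D j) aW L2W).
Qed.

Let e_adapted j k : j != k -> adapted (others F (ssrc k)) (e j).
Proof.
move=> jk; apply: adaptedB => //; apply: adapted_message => // [c'|].
  exact: knows_others.
by apply: knows_others; apply/eqP => -[jk']; rewrite jk' eqxx in jk.
Qed.

Let message_split j o : D j o + e j o = message eta tau o j r (w o).
Proof. by rewrite /e addrC subrK. Qed.

Let next_eq : (fun o => fedcom eta gamma tau o r.+1) =
  fun o => w o - (eta * gamma) *: (m%:R^-1 *: \sum_j (D j o + e j o)).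
Proof.
apply/funext => o /=; congr (_ - _ *: (_ *: _)).
by apply: eq_bigr => j _; rewrite message_split.
Qed.

Let L2v_e j : L2v P (e j). Proof. by have [] := seed_facts j. Qed.

Let n_var j c : Ex P (fun o => sqnorm (n j c o)) <= sigma ^+ 2.
Proof. by have [] := noise_facts (L2v_v j c). Qed.

Let e_var j :
  Ex P (fun o => sqnorm (e j o)) <= q * Ex P (fun o => sqnorm (D j o)).
Proof. by have [] := seed_facts j. Qed.

Let e_orthD j k : Ex P (fun o => dot (D j o) (e k o)) = 0.
Proof. by have [_ _] := seed_facts k; apply. Qed.

Let e_orth j k : j != k -> Ex P (fun o => dot (e j o) (e k o)) = 0.
Proof. by move=> jk; have [_ _] := seed_facts k; apply => //; exact: e_adapted. Qed.

Let psi_adapted (psi : 'rV[R]_d -> 'rV[R]_d) G : adapted G w ->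
  (forall i, measurable_fun setT
    (fun t : d.-tuple R => psi (row_of_tuple t) 0 i)) ->
  adapted G (fun o => psi (w o)).
Proof. by move=> aw mpsi i; exact: measurable_h. Qed.

Let n_mean0 (psi : 'rV[R]_d -> 'rV[R]_d) : (forall i, measurable_fun setT
    (fun t : d.-tuple R => psi (row_of_tuple t) 0 i)) ->
  L2v P (fun o => psi (w o)) ->
  forall j c, Ex P (fun o => dot (psi (w o)) (n j c o)) = 0.
Proof.
move=> mpsi L2psi j c; have [_ _] := noise_facts (L2v_v j c); apply => //.
exact: psi_adapted.
Qed.

Let e_mean0 (psi : 'rV[R]_d -> 'rV[R]_d) : (forall i, measurable_fun setT
    (fun t : d.-tuple R => psi (row_of_tuple t) 0 i)) ->
  L2v P (fun o => psi (w o)) ->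
  forall j, Ex P (fun o => dot (psi (w o)) (e j o)) = 0.
Proof.
move=> mpsi L2psi j; have [_ _] := seed_facts j; apply => //.
exact: psi_adapted.
Qed.

Lemma L2v_next : L2v P (fun o => fedcom eta gamma tau o r.+1).
Proof.
rewrite next_eq; apply: L2vB => //; apply: L2vZ.
exact: (L2v_Qb tau L0 smooth_objective vE L2w L2v_n L2v_e).
Qed.

Hypothesis m_gamma : m%:R <= gamma.
Hypothesis s_le : L * (eta * gamma) * tau%:R * (1 + q / m%:R) <= 2^-1.

Lemma next_descent : Ex P (fun o => f (fedcom eta gamma tau o r.+1)) <=
  Ex P (fun o => f (w o)) -
  eta * gamma * tau%:R / 2 * Ex P (fun o => sqnorm (grad f (w o))) +
  4 * L * (eta * gamma) ^+ 2 * tau%:R * sigma ^+ 2 * (1 + q) / m%:R.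
Proof.
rewrite (_ : (fun o => f _) = fun o =>
    f (w o - (eta * gamma) *: (m%:R^-1 *: \sum_j (D j o + e j o)))); last first.
  by apply/funext => o; rewrite -[in RHS](congr1 (@^~ o) next_eq).
exact (round_descent m_gt0 L0 smooth_objective (q_ge0 HI) (ltW eta0) m_gamma
  (sqr_ge0 sigma) vE L2w L2v_n L2v_e n_var n_orth e_var e_orth e_orthD
  (ws_min HI) n_mean0 e_mean0 s_le).
Qed.

Lemma next_distance : convex f ->
  L / 2 * Ex P (fun o => sqnorm (fedcom eta gamma tau o r.+1 - ws)) <=
  L / 2 * Ex P (fun o => sqnorm (w o - ws)) +
  4 * L * (eta * gamma) ^+ 2 * tau%:R * sigma ^+ 2 * (1 + q) / m%:R.
Proof.
move=> cf; rewrite (_ : (fun o => sqnorm (fedcom _ _ _ o _ - ws)) = fun o =>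
    sqnorm (w o - (eta * gamma) *: (m%:R^-1 *: \sum_j (D j o + e j o)) - ws));
  last by apply/funext => o; rewrite -[in RHS](congr1 (@^~ o) next_eq).
exact (round_distance m_gt0 L0 smooth_objective (q_ge0 HI) (ltW eta0) m_gamma
  (sqr_ge0 sigma) vE L2w L2v_n L2v_e n_var n_orth e_var e_orth e_orthD
  (ws_min HI) n_mean0 e_mean0 s_le cf).
Qed.

End round.

Lemma L2v_fedcom r : L2v P (fun o => fedcom eta gamma tau o r).
Proof. by elim: r => [|r IH]; [exact: L2v_cst|exact: L2v_next]. Qed.

End fedcom_analysis.

(** * Rates *)

Section recursions.
Context {R : realType}.
Implicit Types (a g : nat -> R) (x c k N Delta eps l lo : R).

Lemma descent_sum a g k N n :
  (forall r, a r.+1 <= a r - k * g r + N) ->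
  k * \sum_(r < n) g r <= a 0%N - a n + n%:R * N.
Proof.
move=> h; elim: n => [|n IH].
  by rewrite big_ord0 mulr0 subrr add0r mul0r.
rewrite big_ord_recr /= mulrDr -natr1 mulrDl mul1r.
by have := h n; lra.
Qed.

(** The excess over the fixed point [c] contracts by 1 - x <= exp (- x). The recursion is asked for
    only below [n], since in the convex case the distance is controlled only during the run. *)
Lemma linear_recursion a x c D n : 0 <= x <= 1 ->
  (forall r, (r < n)%N -> a r.+1 <= (1 - x) * a r + x * c) ->
  0 <= D -> a 0%N - c <= D -> a n - c <= expR (- (x * n%:R)) * D.
Proof.
move=> /andP[x0 x1] h D0 a0.
have h1 : a n - c <= (1 - x) ^+ n * D.
  elim: n h => [|n IH] h; first by rewrite expr0 mul1r.
  have {}IH : a n - c <= (1 - x) ^+ n * D.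
    by apply: IH => r rn; apply: h; exact: leqW.
  have := ler_wpM2l (_ : 0 <= 1 - x) IH; rewrite subr_ge0 => /(_ x1).
  by rewrite exprS -mulrA; have := h n (leqnn _); lra.
apply: (le_trans h1); rewrite ler_wpM2r// -mulNr mulrC expRM_natl.
by rewrite lerXn2r ?nnegrE ?subr_ge0 ?expR_ge0//; exact: expR_ge1Dx.
Qed.

(* Beyond the factor [expR (- l)], the surplus [2 * Delta / lo * l] in the
   exponent absorbs the constant [Delta], because [expR t >= 1 + t]. *)
Lemma expR_absorb Delta l lo y : 0 <= Delta -> 0 < lo <= l ->
  (1 + 2 * Delta / lo) * l <= y -> expR (- y) * Delta <= expR (- l) / 2.
Proof.
move=> D0 /andP[lo_gt0 ll] hy.
have h1 : l + 2 * Delta <= y.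
  apply: le_trans hy; rewrite [leRHS]mulrDl mul1r lerD2l -[leRHS]mulrA.
  rewrite ler_peMr ?mulr_ge0//.
  by rewrite mulrC ler_pdivlMr// mul1r.
apply: (@le_trans _ _ (expR (- l - 2 * Delta) * Delta)).
  by rewrite ler_wpM2r// ler_expR; lra.
rewrite expRD -mulrA ler_pM2l ?expR_gt0// expRN.
rewrite ler_pdivrMl ?expR_gt0//.
by have := expR_ge1Dx (2 * Delta); lra.
Qed.

(** The fixed point takes half of [eps] and the decayed initial gap the other half. [lo] is a
    uniform lower bound on ln (1 / eps), which lets the constants depend on [Delta] but not on
    [eps]. *)
Lemma linear_recursion_le a x c Delta eps lo n : 0 <= x <= 1 ->
  (forall r, (r < n)%N -> a r.+1 <= (1 - x) * a r + x * c) ->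
  0 <= c -> c <= eps / 2 ->
  0 < eps -> a 0%N <= Delta -> 0 < lo <= ln eps^-1 ->
  (1 + 2 * `|Delta| / lo) * ln eps^-1 <= x * n%:R -> a n <= eps.
Proof.
move=> x01 h c0 ce eps0 aD lo0 hn.
have := linear_recursion x01 h (normr_ge0 Delta); have := ler_norm Delta.
have := expR_absorb (normr_ge0 Delta) lo0 hn.
rewrite [expR (- ln _)]expRN lnK ?posrE ?invr_gt0// invrK => h1 h2 h3.
by have := h3 ltac:(lra); lra.
Qed.

End recursions.

Section rates.
Context {R : realType} {m d : nat} (I : fed_instance R m d).
Variables (L sigma q eta gamma : R) (ws : 'rV[R]_d) (tau : nat).
Hypotheses (HI : assumptions I L sigma q ws) (L0 : 0 < L) (eta0 : 0 < eta).
Hypothesis m_gamma : m%:R <= gamma.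
Let s := eta * gamma.
Hypothesis s_le : L * s * tau%:R * (1 + q / m%:R) <= 2^-1.

Let P := Pr I.
Let f := objective I.
Let w r o := @fedcom R m d I eta gamma tau o r.
Let N := 4 * L * s ^+ 2 * tau%:R * sigma ^+ 2 * (1 + q) / m%:R.

Definition gap r : R := Ex P (fun o => f (w r o) - f ws).
Definition sq_grad r : R := Ex P (fun o => sqnorm (grad f (w r o))).
Definition sq_dist r : R := Ex P (fun o => sqnorm (w r o - ws)).

Let L2w r : L2v P (w r). Proof. exact: L2v_fedcom HI L0 eta0 r. Qed.
Let sf : smooth L f := smooth_objective HI.
Let fmin := ws_min HI.

Let L1f r : L1 P (fun o => f (w r o)).
Proof. exact: L1_gap L0 sf _ fmin _ (L2w r). Qed.

Let L1gap r : L1 P (fun o => f (w r o) - f ws).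
Proof. exact: L1B (L1f r) (L1_cst P _). Qed.

Let L1grad r : L1 P (fun o => sqnorm (grad f (w r o))).
Proof. by apply: L1_sqnorm; exact: L2v_grad L0 sf _ (L2w r). Qed.

Lemma mean_gapE n : mean_gap I eta gamma tau n ws = (gap n)%:E.
Proof. by rewrite /mean_gap expectationE//; exact: L1gap. Qed.

Lemma mean_sq_gradE n :
  mean_sq_grad I eta gamma tau n = (n%:R^-1 * \sum_(r < n) sq_grad r)%:E.
Proof.
rewrite /mean_sq_grad EFinM -sumEFin; congr (_ * _)%E.
apply: eq_bigr => r _; rewrite expectationE//; exact: L1grad.
Qed.

Lemma gap_ge0 r : 0 <= gap r.
Proof. by apply: Ex_ge0 => o; rewrite subr_ge0; exact: fmin. Qed.

Lemma gap0 : gap 0 = f (w0 I) - f ws.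
Proof. exact: (Ex_cst P (f (w0 I) - f ws)). Qed.

Lemma sq_dist0 : sq_dist 0 = sqnorm (w0 I - ws).
Proof. exact: (Ex_cst P (sqnorm (w0 I - ws))). Qed.

Lemma gap_descent r : gap r.+1 <= gap r - s * tau%:R / 2 * sq_grad r + N.
Proof.
rewrite /gap !(ExB (L1f _) (L1_cst P _)) Ex_cst.
have := next_descent HI L0 eta0 (L2w r) m_gamma s_le.
rewrite -/f -/P -/s -/N -/(w r.+1) -/(w r) -/(sq_grad r); lra.
Qed.

Lemma PL_gap mu r : PL mu f ws -> mu * gap r <= 2^-1 * sq_grad r.
Proof.
move=> plf; have i1 := L1gap r; have i2 := L1grad r.
rewrite -!ExZ//; apply: Ex_le => [||o]; try exact: L1Z.
exact: plf.
Qed.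

Lemma sq_dist_le r : convex f ->
  L / 2 * sq_dist r <= L / 2 * sq_dist 0 + r%:R * N.
Proof.
move=> cf; elim: r => [|r IH]; first by rewrite mul0r addr0.
apply: (le_trans (next_distance HI L0 eta0 (L2w r) m_gamma s_le cf)).
have -> : r.+1%:R * N = r%:R * N + N by rewrite -[r.+1]addn1 natrD mulrDl mul1r.
rewrite addrA; exact: lerD IH (lexx N).
Qed.

Lemma convex_gap r (k : R) : convex f -> 0 < k ->
  2 * gap r <= k * sq_grad r + k^-1 * sq_dist r.
Proof.
move=> cf k0; have i1 := L1gap r; have i2 := L1grad r.
have i3 : L1 P (fun o => sqnorm (w r o - ws)).
  by apply: L1_sqnorm; apply: L2vB => //; exact: L2v_cst.
rewrite -!ExZ// -ExD; try exact: L1Z.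
apply: Ex_le => [||o]; [exact: L1Z|by apply: L1D; exact: L1Z|].
have := convex_ge L0 sf (w r o) (ws - w r o) cf.
rewrite [w r o + _]addrC subrK -[ws - _]opprB dotNr.
have := young_dot (grad f (w r o)) (w r o - ws) k0; lra.
Qed.

End rates.

Section parameters.
Context {R : realType}.

Lemma of_order_gt0 (c A : R) n : 1 <= c -> 0 < A -> of_order c A n -> (0 < n)%N.
Proof.
move=> c1 A0 /andP[h _]; rewrite -(ltr_nat R); apply: lt_le_trans h.
by rewrite mulr_gt0// (lt_le_trans ltr01).
Qed.

(* In parts (ii) and (iii) the effective step [eta * gamma * tau] is
   [1 / (2 L (q / m + 1))], so the smallness condition of [gap_descent] holds
   with equality. *)
Lemma step_condition (L q m gamma tau eta : R) : 0 < L -> 0 <= q -> 0 < m ->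
  0 < gamma -> 0 < tau -> eta = (2 * L * (q / m + 1) * tau * gamma)^-1 ->
  [/\ 0 < eta, eta * gamma * tau = (2 * L * (q / m + 1))^-1 &
      L * (eta * gamma) * tau * (1 + q / m) <= 2^-1].
Proof.
move=> L0 q0 m0 g0 t0 etaE; rewrite (addrC 1); move: etaE.
have : 0 < q / m + 1 by rewrite ltr_wpDl// divr_ge0// ltW.
move: (q / m + 1) => K K0 ->; split.
- by rewrite invr_gt0 !mulr_gt0.
- by field; rewrite !gt_eqF.
- by rewrite le_eqVlt; apply/orP; left; apply/eqP; field; rewrite !gt_eqF.
Qed.

End parameters.

(** * The three rates with explicit constants *)

Section parts.
Context {R : realType} {m d : nat} (I : fed_instance R m d).
Variables (L sigma q : R) (ws : 'rV[R]_d).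
Hypotheses (HI : assumptions I L sigma q ws) (L0 : 0 < L).
Variables (eta gamma eps Delta : R) (rounds tau : nat).
Hypotheses (m_gamma : m%:R <= gamma) (eps0 : 0 < eps).
Hypothesis w0_gap : objective I (w0 I) - objective I ws <= Delta.

Let mR : 0 < m%:R :> R. Proof. by rewrite ltr0n (m_gt0 HI). Qed.
Let q0 := q_ge0 HI.
Let gamma0 : 0 < gamma. Proof. exact: lt_le_trans m_gamma. Qed.
Let q1 : 0 < q + 1. Proof. by rewrite ltr_wpDl. Qed.

(** The first lower bound on [cR] secures the step condition, the second the final estimate. *)
Lemma nonconvex_rate (rho cR : R) : 0 < rho -> q <= rho * m%:R ->
  8 * (1 + rho) ^+ 2 <= cR -> (2 * L * `|Delta| + 8 * sigma ^+ 2) ^+ 2 <= cR ->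
  eta = (L * gamma)^-1 * Num.sqrt (m%:R / (rounds%:R * tau%:R * (q + 1))) ->
  of_order cR (Num.max 1 eps^-1) rounds ->
  of_order 1 ((q + 1) / (m%:R * eps)) tau ->
  (mean_sq_grad I eta gamma tau rounds <= eps%:E)%E.
Proof.
move: (L0) (eps0) (w0_gap) (q0) => L_gt0 eps_gt0 w0_le q_ge0.
move=> rho0 qrho cR1 cR2 etaE hR ht.
have cR_ge1 : 1 <= cR by apply: le_trans cR1; nra.
have cR0 : 0 < cR by lra.
have tau0 : 0 < tau%:R :> R.
  by rewrite ltr0n; apply: of_order_gt0 ht => //; rewrite divr_gt0// mulr_gt0.
have R0 : 0 < rounds%:R :> R.
  rewrite ltr0n; apply: of_order_gt0 hR => //.
  by rewrite lt_max ltr01.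
have Reps : cR <= rounds%:R * eps.
  have /andP[h _] := hR; rewrite -ler_pdivrMr//; apply: le_trans h.
  by rewrite ler_pM2l// le_max lexx orbT.
have /andP[tl tu] := ht; rewrite mul1r in tl; rewrite mulr1 in tu.
(* [y] equals L eta gamma. Squared, the step condition reads tau m (1 + q / m)^2 / (R (q + 1)) <=
   1/4, and the upper bound on [tau] reduces it to 2 (1 + rho)^2 / (R eps) <= 1/4. *)
set y := Num.sqrt _ in etaE.
have y2 : y ^+ 2 = m%:R / (rounds%:R * tau%:R * (q + 1)).
  by rewrite sqr_sqrtr// divr_ge0 ?ltW// !mulr_gt0.
have y0 : 0 < y by rewrite sqrtr_gt0 divr_gt0// !mulr_gt0.
have eta_gt0 : 0 < eta by rewrite etaE mulr_gt0// invr_gt0 mulr_gt0.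
have sE : eta * gamma = y / L by rewrite etaE; field; rewrite !gt_eqF.
have y2E : y ^+ 2 * (rounds%:R * tau%:R * (q + 1)) = m%:R.
  by rewrite y2 divfK// gt_eqF// !mulr_gt0.
have tl' : q + 1 <= tau%:R * (m%:R * eps) by rewrite -ler_pdivrMr ?mulr_gt0.
have tu' : tau%:R * (m%:R * eps) <= 2 * (q + 1).
  by rewrite -ler_pdivlMr ?mulr_gt0// -mulrA.
have s_le : L * (eta * gamma) * tau%:R * (1 + q / m%:R) <= 2^-1.
  have -> : L * (eta * gamma) * tau%:R * (1 + q / m%:R) =
      y * tau%:R * (1 + q / m%:R) by rewrite sE; field; rewrite !gt_eqF.
  have p0 : 0 <= 1 + q / m%:R by rewrite addr_ge0// divr_ge0// ltW.
  rewrite -(ler_pXn2r (n := 2)) ?nnegrE ?mulr_ge0 ?(ltW y0) ?(ltW tau0)//.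
  have prho : (1 + q / m%:R) ^+ 2 <= (1 + rho) ^+ 2.
    by rewrite lerXn2r ?nnegrE ?lerD2l ?ler_pdivrMr//; lra.
  have -> : (y * tau%:R * (1 + q / m%:R)) ^+ 2 =
      tau%:R * m%:R * (1 + q / m%:R) ^+ 2 / (rounds%:R * (q + 1)).
    rewrite !exprMn y2; set p := (1 + _) ^+ 2.
    by field; rewrite !gt_eqF.
  rewrite ler_pdivrMr ?mulr_gt0// -(ler_pM2r eps0).
  have -> : tau%:R * m%:R * (1 + q / m%:R) ^+ 2 * eps =
    tau%:R * (m%:R * eps) * (1 + q / m%:R) ^+ 2 by ring.
  have -> : 2^-1 ^+ 2 * (rounds%:R * (q + 1)) * eps =
    4^-1 * (q + 1) * (rounds%:R * eps) by field.
  apply: (@le_trans _ _ (2 * (q + 1) * (1 + rho) ^+ 2)).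
    by apply: ler_pM => //; rewrite ?sqr_ge0// !mulr_ge0// ltW.
  have : (q + 1) * (8 * (1 + rho) ^+ 2) <= (q + 1) * (rounds%:R * eps).
    by rewrite ler_pM2l//; exact: le_trans Reps.
  by lra.
have := descent_sum rounds (gap_descent HI L0 eta_gt0 m_gamma s_le).
rewrite (mean_sq_gradE gamma tau HI L0 eta_gt0) lee_fin gap0 ler_pdivrMl//.
set S := \sum_(r < rounds) _; set N := (_ / m%:R) => hS.
(* The step size is tuned so that the noise accumulated over all rounds is a constant of the
   problem. *)
have RN : rounds%:R * N = 4 * sigma ^+ 2 / L.
  have -> : rounds%:R * N = 4 * sigma ^+ 2 / L *
      (y ^+ 2 * (rounds%:R * tau%:R * (q + 1))) / m%:R.
    by rewrite /N sE; field; rewrite !gt_eqF.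
  by rewrite y2E -mulrA divff ?mulr1// gt_eqF.
(* The square of the right-hand side is R eps times tau m eps / (q + 1), and the latter factor is at
   least 1. *)
have K_le : 2 * L * `|Delta| + 8 * sigma ^+ 2 <= y * tau%:R * rounds%:R * eps.
  rewrite -(ler_pXn2r (isT : (0 < 2)%N)) ?nnegrE; last 2 first.
  - have LD : 0 <= L * `|Delta| by rewrite mulr_ge0// ltW.
    by have := sqr_ge0 sigma; lra.
  - by rewrite ltW// !mulr_gt0.
  apply: (le_trans cR2); apply: (le_trans Reps).
  have -> : (y * tau%:R * rounds%:R * eps) ^+ 2 =
    rounds%:R * eps * (tau%:R * (m%:R * eps) / (q + 1)).
    by rewrite !exprMn y2; field; rewrite !gt_eqF.
  by rewrite ler_pMr ?mulr_gt0// ler_pdivlMr// mul1r.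
have k0 : 0 < eta * gamma * tau%:R / 2 by rewrite sE !mulr_gt0// invr_gt0.
rewrite -(ler_pM2l k0); apply: (le_trans hS); rewrite RN.
have gap_n := gap_ge0 eta gamma tau HI rounds.
have Dn := ler_norm Delta.
apply: (@le_trans _ _ (`|Delta| + 4 * sigma ^+ 2 / L)); first lra.
have -> : eta * gamma * tau%:R / 2 * (rounds%:R * eps) =
  (y * tau%:R * rounds%:R * eps) / (2 * L) by rewrite sE; field; rewrite !gt_eqF.
rewrite ler_pdivlMr ?mulr_gt0//.
have -> : (`|Delta| + 4 * sigma ^+ 2 / L) * (2 * L) =
  2 * L * `|Delta| + 8 * sigma ^+ 2 by field; rewrite gt_eqF.
exact: K_le.
Qed.

Let K := q / m%:R + 1.
Let K_ge1 : 1 <= K. Proof. by rewrite lerDr divr_ge0// ltW. Qed.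
Let K0 : 0 < K. Proof. exact: lt_le_trans K_ge1. Qed.
Let K_le : K <= q + 1.
Proof.
by rewrite lerD2r ler_pdivrMr// ler_peMr// ler1n (m_gt0 HI).
Qed.

Hypothesis etaE : eta = (2 * L * K * tau%:R * gamma)^-1.
Hypothesis tau_gt0 : (0 < tau)%N.

Let tau0 : 0 < tau%:R :> R. Proof. by rewrite ltr0n. Qed.
Let step := step_condition L0 q0 mR gamma0 tau0 etaE.
Let eta0 : 0 < eta. Proof. by case: step. Qed.
Let S := (2 * L * K)^-1.
Let stepE : eta * gamma * tau%:R = S. Proof. by case: step. Qed.
Let S0 : 0 < S. Proof. by rewrite invr_gt0 !mulr_gt0. Qed.
Let s_le : L * (eta * gamma) * tau%:R * (1 + q / m%:R) <= 2^-1.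
Proof. by case: step. Qed.
Let N := 4 * L * S ^+ 2 * sigma ^+ 2 * (q + 1) / (m%:R * tau%:R).
Let a := gap I eta gamma ws tau.
Let g := sq_grad I eta gamma tau.

Let NE : 4 * L * (eta * gamma) ^+ 2 * tau%:R * sigma ^+ 2 * (1 + q) / m%:R = N.
Proof.
rewrite /N -stepE (addrC 1); move: (q + 1) => p.
by field; rewrite !gt_eqF.
Qed.

Let N_ge0 : 0 <= N.
Proof.
apply: divr_ge0; last by rewrite ltW// mulr_gt0.
rewrite mulr_ge0 ?(ltW q1)// mulr_ge0 ?sqr_ge0// mulr_ge0 ?sqr_ge0//.
by rewrite mulr_ge0 ?(ltW L0).
Qed.

Let a_descent r : a r.+1 <= a r - S / 2 * g r + N.
Proof. by have := gap_descent HI L0 eta0 m_gamma s_le r; rewrite stepE NE. Qed.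

(** mu' <= L keeps the contraction rate S mu' at most 1 without comparing [mu] with [L]; the lost
    factor mu / mu' is charged to [cR]. The fixed point N / (S mu') is at most eps / 2 by the choice
    of [ctau]. *)
Lemma PL_rate (mu mu' lo cR ctau : R) : 0 < mu' -> mu' <= mu -> mu' <= L ->
  PL mu (objective I) ws -> 0 < lo <= ln eps^-1 ->
  2 * (mu / mu') * (1 + 2 * `|Delta| / lo) <= cR -> 4 * sigma ^+ 2 / mu' <= ctau ->
  cR * (K * (L / mu) * ln eps^-1) <= rounds%:R ->
  ctau * ((q + 1) / (m%:R * K * eps)) <= tau%:R ->
  (mean_gap I eta gamma tau rounds ws <= eps%:E)%E.
Proof.
move: (L0) (eps0) (K_ge1) (q0) => L_gt0 eps_gt0 K1 q_ge0.
move=> mu'0 mu'mu mu'L plf lo_ln hcR hctau hR ht.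
have mu0 : 0 < mu by exact: lt_le_trans mu'mu.
rewrite (mean_gapE gamma tau HI L0 eta0) lee_fin.
have x0 : 0 < S * mu' by rewrite mulr_gt0.
have x1 : S * mu' <= 1.
  rewrite mulrC ler_pdivrMr ?mul1r ?mulr_gt0//.
  by have : L <= L * K by [rewrite ler_peMr// ltW]; lra.
apply: (@linear_recursion_le _ a (S * mu') (N / (S * mu')) Delta eps lo) => //.
- by rewrite ltW.
- move=> r _; rewrite mulrCA divff ?gt_eqF// mulr1.
  have ag : mu' * a r <= 2^-1 * g r.
    apply: (@le_trans _ _ (mu * a r)); first by rewrite ler_wpM2r// (gap_ge0 _ _ _ HI).
    exact: (PL_gap gamma tau HI L0 eta0 r plf).
  have : S * (mu' * a r) <= S * (2^-1 * g r) by rewrite ler_pM2l.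
  by have := a_descent r; lra.
- by rewrite divr_ge0// ltW.
- have h : 4 * sigma ^+ 2 / mu' * (q + 1) <= tau%:R * (m%:R * K * eps).
    rewrite -ler_pdivrMr ?mulr_gt0//; apply: le_trans ht.
    by rewrite -[leLHS]mulrA ler_wpM2r// ltW// divr_gt0// !mulr_gt0.
  have -> : N / (S * mu') =
      4 * sigma ^+ 2 / mu' * (q + 1) / (2 * (tau%:R * m%:R * K)).
    rewrite /N /S; move: (q + 1) => p.
    by field; rewrite !gt_eqF.
  rewrite ler_pdivrMr ?mulr_gt0//; apply: (le_trans h).
  by rewrite le_eqVlt; apply/orP; left; apply/eqP; field.
- by rewrite /a gap0.
- have ln0 : 0 <= ln eps^-1 by case/andP: lo_ln; lra.
  apply: (@le_trans _ _ (S * mu' * (cR * (K * (L / mu) * ln eps^-1)))); last first.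
    by rewrite ler_pM2l.
  have -> : S * mu' * (cR * (K * (L / mu) * ln eps^-1)) =
      (mu' / (2 * mu)) * cR * ln eps^-1.
    by rewrite /S; field; rewrite !gt_eqF.
  rewrite ler_wpM2r// -ler_pdivrMl ?divr_gt0 ?mulr_gt0//.
  apply: le_trans hcR; rewrite le_eqVlt; apply/orP; left; apply/eqP.
  by move: (1 + _) => p; field; rewrite !gt_eqF.
Qed.

(** [B] bounds the mean squared distance to [ws] over the run: 2 (D^2 + D0^2) covers its initial
    value and the last term the accumulated noise. The summand 1 / L gives L B >= 1, which keeps the
    contraction rate at most 1. *)
Lemma convex_rate (B D D0 lo cR ctau : R) : convex (objective I) ->
  l2norm ws <= D -> l2norm (w0 I) <= D0 -> eps <= 1 -> 0 < lo <= ln eps^-1 ->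
  B = 1 + L^-1 + 2 * (D ^+ 2 + D0 ^+ 2) + 4 * sigma ^+ 2 * (1 + L) / L ^+ 2 ->
  4 * B * (1 + 2 * `|Delta| / lo) <= cR -> 16 * sigma ^+ 2 * B <= ctau ->
  0 < cR <= ctau ->
  of_order cR (Num.max 1 (L * (1 + q / m%:R) / eps * ln eps^-1)) rounds ->
  ctau * ((q + 1) ^+ 2 / (m%:R * K ^+ 2 * eps ^+ 2)) <= tau%:R ->
  (mean_gap I eta gamma tau rounds ws <= eps%:E)%E.
Proof.
move: (L0) (eps0) (K_ge1) (q0) => L_gt0 eps_gt0 K1 q_ge0.
move=> cf wsD w0D eps1 lo_ln BE hcR hctau /andP[cR0 cRtau] /andP[hRl hRu] ht.
rewrite (mean_gapE gamma tau HI L0 eta0) lee_fin.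
rewrite (addrC 1) -/K in hRl hRu.
have Li0 : 0 < L^-1 by rewrite invr_gt0.
have sig2 := sqr_ge0 sigma.
have T0 : 0 <= 4 * sigma ^+ 2 * (1 + L) / L ^+ 2.
  apply: divr_ge0; last exact: sqr_ge0.
  by apply: mulr_ge0; [apply: mulr_ge0|lra].
have [D2 D02] := (sqr_ge0 D, sqr_ge0 D0).
have BL : L^-1 <= B by lra.
have B0 : 0 < B by lra.
have ctau0 : 0 < ctau by exact: lt_le_trans cRtau.
have ln0 : 0 <= ln eps^-1 by case/andP: lo_ln; lra.
have eln : eps * ln eps^-1 <= 1.
  have := expR_ge1Dx (ln eps^-1); rewrite lnK ?posrE ?invr_gt0// => h.
  have : eps * (1 + ln eps^-1) <= eps * eps^-1 by rewrite ler_pM2l.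
  by rewrite divff ?gt_eqF//; lra.
have tE : ctau * (q + 1) ^+ 2 <= tau%:R * (m%:R * K ^+ 2 * eps ^+ 2).
  by rewrite -ler_pdivrMr ?mulr_gt0 ?exprn_gt0// -[leLHS]mulrA.
have N_le : N <= sigma ^+ 2 * eps ^+ 2 / (L * ctau * (q + 1)).
  have -> : N = sigma ^+ 2 * (q + 1) / (L * K ^+ 2 * m%:R * tau%:R).
    rewrite /N /S; move: (q + 1) => p.
    by field; rewrite !gt_eqF.
  rewrite ler_pdivrMr ?mulr_gt0 ?exprn_gt0//.
  have -> : sigma ^+ 2 * eps ^+ 2 / (L * ctau * (q + 1)) *
      (L * K ^+ 2 * m%:R * tau%:R) =
    sigma ^+ 2 * (tau%:R * (m%:R * K ^+ 2 * eps ^+ 2) / (ctau * (q + 1))).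
    by field; rewrite !gt_eqF.
  rewrite ler_wpM2l// ler_pdivlMr ?mulr_gt0//.
  by rewrite mulrCA -expr2.
(* This uses the upper half of [of_order] for the rounds: a longer run could let the distance grow.
   The ratio cR / ctau <= 1 and eps ln (1 / eps) <= 1 remove the dependence on the constants and on
   [eps]. *)
have RN : rounds%:R * N <= 2 * sigma ^+ 2 * (1 + L) / L.
  have p1 : 1 <= q + 1 by rewrite lerDr.
  have maxE : Num.max 1 (L * K / eps * ln eps^-1) * eps ^+ 2 <= (1 + L) * (q + 1).
    have [h|h] := leP 1 (L * K / eps * ln eps^-1).
      have -> : L * K / eps * ln eps^-1 * eps ^+ 2 = L * K * (eps * ln eps^-1).
        by field; rewrite gt_eqF.
      apply: (@le_trans _ _ (L * (q + 1) * 1)); last first.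
        by rewrite mulr1 ler_pM2r//; lra.
      apply: ler_pM => //; last by rewrite ler_pM2l.
        by rewrite ltW// mulr_gt0.
      by rewrite mulr_ge0// ltW.
    rewrite mul1r; apply: (@le_trans _ _ 1); first by rewrite exprn_ile1// ltW.
    by have : L <= L * (q + 1) by [rewrite ler_peMr// ltW]; lra.
  apply: (@le_trans _ _ (2 * cR * Num.max 1 (L * K / eps * ln eps^-1) *
      (sigma ^+ 2 * eps ^+ 2 / (L * ctau * (q + 1))))).
    by apply: ler_pM.
  have -> : 2 * cR * Num.max 1 (L * K / eps * ln eps^-1) *
      (sigma ^+ 2 * eps ^+ 2 / (L * ctau * (q + 1))) =
    2 * sigma ^+ 2 * (cR / ctau) / L *
      (Num.max 1 (L * K / eps * ln eps^-1) * eps ^+ 2 / (q + 1)).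
    by move: (Num.max _ _) => M; field; rewrite !gt_eqF.
  have -> : 2 * sigma ^+ 2 * (1 + L) / L = 2 * sigma ^+ 2 * 1 / L * (1 + L).
    by field; rewrite gt_eqF.
  have cc : cR / ctau <= 1 by rewrite ler_pdivrMr// mul1r.
  apply: ler_pM.
  - apply: divr_ge0; last exact: ltW.
    by apply: mulr_ge0; [rewrite mulr_ge0|rewrite ltW// divr_gt0].
  - rewrite divr_ge0 ?(ltW q1)// mulr_ge0 ?sqr_ge0//.
    by rewrite le_max ler01.
  - by rewrite ler_pM2r// ler_wpM2l// mulr_ge0.
  - by rewrite ler_pdivrMr.
have b_le r : (r < rounds)%N -> sq_dist I eta gamma ws tau r <= B.
  move=> rn; have := sq_dist_le HI L0 eta0 m_gamma s_le r cf.
  rewrite sq_dist0 NE => h.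
  have rN : r%:R * N <= rounds%:R * N by rewrite ler_wpM2r// ler_nat ltnW.
  have w0ws : sqnorm (w0 I - ws) <= 2 * (D ^+ 2 + D0 ^+ 2).
    apply: (le_trans (sqnormD_le2 _ _)); rewrite sqnormN -!l2norm_sq.
    have n0 u : 0 <= l2norm u :> R by exact: sqrtr_ge0.
    have h1 : l2norm ws ^+ 2 <= D ^+ 2.
      by rewrite lerXn2r// ?nnegrE//; exact: le_trans wsD.
    have h2 : l2norm (w0 I) ^+ 2 <= D0 ^+ 2.
      by rewrite lerXn2r// ?nnegrE//; exact: le_trans w0D.
    by lra.
  have : 2 / L * (L / 2 * sq_dist I eta gamma ws tau r) <=
      2 / L * (L / 2 * sqnorm (w0 I - ws) + 2 * sigma ^+ 2 * (1 + L) / L).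
    by rewrite ler_pM2l ?divr_gt0//; lra.
  have -> : 2 / L * (L / 2 * sq_dist I eta gamma ws tau r) =
      sq_dist I eta gamma ws tau r by field; rewrite gt_eqF.
  have -> : 2 / L * (L / 2 * sqnorm (w0 I - ws) + 2 * sigma ^+ 2 * (1 + L) / L) =
      sqnorm (w0 I - ws) + 4 * sigma ^+ 2 * (1 + L) / L ^+ 2.
    by field; rewrite gt_eqF.
  by lra.
(* The rate obtained from [convex_gap] with k = 2 B / eps: the distance term then adds eps / 4 to
   the fixed point, and the noise term N / x is at most another eps / 4. *)
pose x := S * eps / (2 * B).
have x0 : 0 < x by rewrite divr_gt0 ?mulr_gt0.
have x1 : x <= 1.
  have -> : x = eps / (4 * (L * B) * K) by rewrite /x /S; field; rewrite !gt_eqF.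
  have LB : 1 <= L * B by rewrite -ler_pdivrMl// mulr1.
  have LBK : L * B <= L * B * K by rewrite ler_peMr//; lra.
  by rewrite ler_pdivrMr ?mul1r ?mulr_gt0//; lra.
apply: (@linear_recursion_le _ a x (eps / 4 + N / x) Delta eps lo) => //.
- by rewrite ltW.
- move=> r rn; have e0 : 0 < 2 * B / eps by rewrite divr_gt0 ?mulr_gt0.
  have := convex_gap gamma tau HI L0 eta0 r cf e0; rewrite -/(a r) -/(g r) => h.
  have hb : (2 * B / eps)^-1 * sq_dist I eta gamma ws tau r <= eps / 2.
    rewrite ler_pdivrMl//.
    have -> : 2 * B / eps * (eps / 2) = B by field; rewrite gt_eqF.
    exact: b_le.
  have : x * a r <= x * (B / eps * g r + eps / 4).
    by rewrite ler_pM2l//; move: h; lra.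
  have -> : x * (B / eps * g r + eps / 4) = S / 2 * g r + x * (eps / 4).
    by rewrite /x; field; rewrite !gt_eqF.
  have -> : x * (eps / 4 + N / x) = x * (eps / 4) + N.
    by field; rewrite gt_eqF.
  by have := a_descent r; lra.
- by apply: addr_ge0; apply: divr_ge0 => //; exact: ltW.
- suff : N / x <= eps / 4 by lra.
  have -> : N / x = 4 * sigma ^+ 2 * B * (q + 1) / (K * m%:R * tau%:R * eps).
    rewrite /N /x /S; move: (q + 1) => p.
    by field; rewrite !gt_eqF.
  rewrite ler_pdivrMr ?mulr_gt0//.
  rewrite -(ler_pM2l q1).
  have hK : K * (tau%:R * m%:R * K * eps ^+ 2) <=
      (q + 1) * (tau%:R * m%:R * K * eps ^+ 2).
    by rewrite ler_pM2r// !mulr_gt0// exprn_gt0.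
  have hB : 16 * sigma ^+ 2 * B * (q + 1) ^+ 2 <= ctau * (q + 1) ^+ 2.
    by rewrite ler_pM2r// exprn_gt0.
  have e1 : K * (tau%:R * m%:R * K * eps ^+ 2) =
      tau%:R * (m%:R * K ^+ 2 * eps ^+ 2) by ring.
  have e2 : (q + 1) * (eps / 4 * (K * m%:R * tau%:R * eps)) =
      (q + 1) * (tau%:R * m%:R * K * eps ^+ 2) / 4 by field.
  have e3 : (q + 1) * (4 * sigma ^+ 2 * B * (q + 1)) =
      16 * sigma ^+ 2 * B * (q + 1) ^+ 2 / 4 by field.
  by rewrite e2 e3 ler_pM2r ?invr_gt0//; lra.
- by rewrite /a gap0.
- apply: (@le_trans _ _ (x * (cR * (L * K / eps * ln eps^-1)))); last first.
    rewrite ler_pM2l//; apply: le_trans hRl.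
    by rewrite ler_pM2l// le_max lexx orbT.
  have -> : x * (cR * (L * K / eps * ln eps^-1)) = cR / (4 * B) * ln eps^-1.
    by rewrite /x /S; field; rewrite !gt_eqF.
  by rewrite ler_wpM2r// ler_pdivlMr ?mulr_gt0// mulrC.
Qed.

End parts.

Theorem theorem5p1 (R : realType) (L sigma Delta : R)
    (L_gt0 : 0 < L) (sigma_ge0 : 0 <= sigma) :
  (* No constant uniform in q / m exists here: relative compression noise of
     variance q / m forces at least of the order of q / m rounds. *)
  (forall rho : R, 0 < rho ->
    exists cR ctau : R, [/\ 1 <= cR, 1 <= ctau &
    forall (m d : nat) (I : fed_instance R m d) (ws : 'rV[R]_d)
      (q eps gamma eta : R) (rounds tau : nat),
    assumptions I L sigma q ws ->
    objective I (w0 I) - objective I ws <= Delta ->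
    q <= rho * m%:R ->
    0 < eps ->
    m%:R <= gamma ->
    eta = (L * gamma)^-1
          * Num.sqrt (m%:R / (rounds%:R * tau%:R * (q + 1))) ->
    of_order cR (Num.max 1 eps^-1) rounds ->
    of_order ctau ((q + 1) / (m%:R * eps)) tau ->
    (mean_sq_grad I eta gamma tau rounds <= eps%:E)%E])
  /\
  (forall mu eps0 : R, 0 < mu -> eps0 < 1 ->
    exists cR ctau : R, [/\ 1 <= cR, 1 <= ctau &
    forall (m d : nat) (I : fed_instance R m d) (ws : 'rV[R]_d)
      (q eps gamma eta : R) (rounds tau : nat),
    let kappa := L / mu in
    assumptions I L sigma q ws ->
    objective I (w0 I) - objective I ws <= Delta ->
    strongly_convex mu (objective I) \/ PL mu (objective I) ws ->
    0 < eps <= eps0 ->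
    m%:R <= gamma ->
    eta = (2 * L * (q / m%:R + 1) * tau%:R * gamma)^-1 ->
    of_order cR (Num.max 1 ((q / m%:R + 1) * kappa * ln eps^-1)) rounds ->
    of_order ctau (Num.max 1 ((q + 1) / (m%:R * (q / m%:R + 1) * eps))) tau ->
    (mean_gap I eta gamma tau rounds ws <= eps%:E)%E])
  /\
  (forall D D0 eps0 : R, eps0 < 1 ->
    exists cR ctau : R, [/\ 1 <= cR, 1 <= ctau &
    forall (m d : nat) (I : fed_instance R m d) (ws : 'rV[R]_d)
      (q eps gamma eta : R) (rounds tau : nat),
    assumptions I L sigma q ws ->
    objective I (w0 I) - objective I ws <= Delta ->
    l2norm ws <= D ->
    l2norm (w0 I) <= D0 ->
    convex (objective I) ->
    0 < eps <= eps0 ->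
    m%:R <= gamma ->
    eta = (2 * L * (q / m%:R + 1) * tau%:R * gamma)^-1 ->
    of_order cR (Num.max 1 (L * (1 + q / m%:R) / eps * ln eps^-1)) rounds ->
    of_order ctau (Num.max 1
      ((q + 1) ^+ 2 / (m%:R * (q / m%:R + 1) ^+ 2 * eps ^+ 2))) tau ->
    (mean_gap I eta gamma tau rounds ws <= eps%:E)%E]).
Proof.
split; [|split].
- move=> rho rho0.
  set c1 := 8 * (1 + rho) ^+ 2.
  set c2 := (2 * L * `|Delta| + 8 * sigma ^+ 2) ^+ 2.
  have c1_ge1 : 1 <= c1 by rewrite /c1; nra.
  have c2_ge0 : 0 <= c2 by exact: sqr_ge0.
  exists (c1 + c2), 1; split=> //; first by lra.
  move=> m d I ws q eps gamma eta rounds tau HI w0_gap qrho eps0 m_gamma etaE hR ht.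
  by apply: (nonconvex_rate HI L_gt0 m_gamma eps0 w0_gap rho0 qrho _ _ etaE hR ht);
    rewrite -/c1 -/c2; lra.
- move=> mu eps0 mu0 eps0_lt1.
  have [eps0_le0|eps0_gt0] := leP eps0 0.
    exists 1, 1; split=> // m d I ws q eps gamma eta rounds tau kappa _ _ _.
    by move=> /andP[e0 e1]; have := lt_le_trans e0 e1; rewrite ltNge eps0_le0.
  (* As eps <= eps0 < 1, ln (1 / eps) stays above [lo], so a multiple of it can absorb the initial
     gap. *)
  set lo := ln eps0^-1; have lo_gt0 : 0 < lo by rewrite ln_gt0// invf_gt1.
  set mu' := Num.min mu L; have mu'0 : 0 < mu' by rewrite lt_min mu0.
  have mu'mu : mu' <= mu by rewrite ge_min lexx.
  have mu'L : mu' <= L by rewrite ge_min lexx orbT.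
  set cR := 2 * (mu / mu') * (1 + 2 * `|Delta| / lo).
  have D_lo : 0 <= 2 * `|Delta| / lo by rewrite divr_ge0 ?mulr_ge0// ltW.
  have mm : 1 <= mu / mu' by rewrite ler_pdivlMr// mul1r.
  have cR1 : 1 <= cR by rewrite /cR; nra.
  have s0 : 0 <= 4 * sigma ^+ 2 / mu'.
    by apply: divr_ge0; [rewrite mulr_ge0// sqr_ge0|exact: ltW].
  exists cR, (1 + 4 * sigma ^+ 2 / mu'); split=> //; first by rewrite lerDl.
  move=> m d I ws q eps gamma eta rounds tau kappa HI w0_gap cvx /andP[e0 e1].
  move=> m_gamma etaE /andP[hR _] ht.
  have plf : PL mu (objective I) ws.
    by case: cvx => // cvx; exact: strongly_convex_PL L_gt0 (smooth_objective HI) _ _ mu0 cvx.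
  have tau_gt0 : (0 < tau)%N.
    by apply: (of_order_gt0 _ _ ht); [rewrite lerDl|rewrite lt_max ltr01].
  have lo_ln : 0 < lo <= ln eps^-1.
    by rewrite lo_gt0 ler_ln ?posrE ?invr_gt0// lef_pV2 ?posrE.
  apply: (PL_rate HI L_gt0 m_gamma e0 w0_gap etaE tau_gt0 mu'0 mu'mu mu'L plf lo_ln
    (lexx cR) (ctau := 1 + 4 * sigma ^+ 2 / mu')).
  + by rewrite lerDr.
  + apply: le_trans hR; rewrite ler_pM2l; last by lra.
    by rewrite le_max lexx orbT.
  + have /andP[+ _] := ht; apply: le_trans; rewrite ler_pM2l; last by lra.
    by rewrite le_max lexx orbT.
- move=> D D0 eps0 eps0_lt1.
  have [eps0_le0|eps0_gt0] := leP eps0 0.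
    exists 1, 1; split=> // m d I ws q eps gamma eta rounds tau _ _ _ _ _.
    by move=> /andP[e0 e1]; have := lt_le_trans e0 e1; rewrite ltNge eps0_le0.
  set lo := ln eps0^-1; have lo_gt0 : 0 < lo by rewrite ln_gt0// invf_gt1.
  set B := 1 + L^-1 + 2 * (D ^+ 2 + D0 ^+ 2)
           + 4 * sigma ^+ 2 * (1 + L) / L ^+ 2.
  have sig2 := sqr_ge0 sigma.
  have B1 : 1 <= B.
    have T0 : 0 <= 4 * sigma ^+ 2 * (1 + L) / L ^+ 2.
      apply: divr_ge0; last exact: sqr_ge0.
      by apply: mulr_ge0; [apply: mulr_ge0|lra].
    have Li0 : 0 < L^-1 by rewrite invr_gt0.
    by have [D2 D02] := (sqr_ge0 D, sqr_ge0 D0); rewrite /B; lra.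
  set cR := 4 * B * (1 + 2 * `|Delta| / lo).
  have D_lo : 0 <= 2 * `|Delta| / lo by rewrite divr_ge0 ?mulr_ge0// ltW.
  have cR1 : 1 <= cR by rewrite /cR; nra.
  have sB : 0 <= 16 * sigma ^+ 2 * B by rewrite mulr_ge0 ?mulr_ge0//; lra.
  (* The summand [cR] in the constant for [tau] provides cR <= ctau, which [convex_rate] needs to
     bound the accumulated noise. *)
  exists cR, (cR + 16 * sigma ^+ 2 * B); split=> //; first lra.
  move=> m d I ws q eps gamma eta rounds tau HI w0_gap wsD w0D cf /andP[e0 e1].
  move=> m_gamma etaE hR ht.
  have tau_gt0 : (0 < tau)%N.
    by apply: (of_order_gt0 _ _ ht); [lra|rewrite lt_max ltr01].
  have lo_ln : 0 < lo <= ln eps^-1.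
    by rewrite lo_gt0 ler_ln ?posrE ?invr_gt0// lef_pV2 ?posrE.
  apply: (convex_rate HI L_gt0 m_gamma e0 w0_gap etaE tau_gt0 cf wsD w0D _ lo_ln
    (erefl B) (lexx cR) (ctau := cR + 16 * sigma ^+ 2 * B) _ _ hR).
  + lra.
  + lra.
  + by apply/andP; split; lra.
  + have /andP[+ _] := ht; apply: le_trans; rewrite ler_pM2l; last by lra.
    by rewrite le_max lexx orbT.
Qed.
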